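(* Let $\Gamma$ be a finite group, $\lambda\in\mathcal P(\Gamma_* )$, $r\ge1$, and $c\in\Gamma_*$ with $c\ne c^0$. Then the product $K_\lambda K_{(r)_c}$ in the Farahat–Higman ring $\mathcal G_\Gamma$ is $$K_\lambda K_{(r)_c}=\sum_{\mu}\frac{\bigl(m_{|\mu|+r}(\lambda(c))+1\bigr)\cdot(|\mu|+r)\cdot(r-1)!}{(r-\ell(\mu))!\,\prod_{i\ge1}m_i(\mu)!}\;K_{\lambda\cup(|\mu|+r)_c-\mu},$$ summed over all partitions $\mu\subset\lambda(c^0)$ (including $\mu=\emptyset$), regarded as elements of $\mathcal P(\Gamma_* )$ supported at $c^0$, such that $\ell(\mu)\le r$.
   Context: $\Gamma_*$ is the set of conjugacy classes of $\Gamma$, and $c^0=\{1\}$. $S_n$ acts on $\Gamma^n$ by $\sigma(g_1,\dots,g_n)=(g_{\sigma^{-1}(1)},\dots,g_{\sigma^{-1}(n)})$, and $\Gamma_n=\Gamma^n\rtimes S_n$ with $(g,\sigma)(h,\tau)=(g\,\sigma(h),\sigma\tau)$. For $x=(g,\sigma)$ and a cycle $(i_1\cdots i_k)$ of $\sigma$ (fixed points are 1-cycles), the cycle-product is $g_{i_k}\cdots g_{i_1}$, well defined up to conjugacy. For a partition $\mu$: $|\mu|$ is the sum of its parts, $\ell(\mu)$ the number of parts, $m_i(\mu)$ the number of parts equal to $i$. For partitions, $\mu\subset\lambda$ means the parts of $\mu$ form a sub-multiset of the parts of $\lambda$; $\lambda\cup\mu$ is the multiset union of parts, and $\lambda-\mu$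 is obtained by removing the parts of $\mu$. $\mathcal P(\Gamma_* )$ is the set of partition-valued functions on $\Gamma_*$, with $\cup$, $-$ defined pointwise and $\|\lambda\|=\sum_c|\lambda(c)|$; $(k)_c\in\mathcal P(\Gamma_* )$ has the one-part partition $(k)$ at $c$ and empty partitions elsewhere. The type $\rho$ of $x\in\Gamma_n$: $m_i(\rho(c))$ is the number of $i$-cycles of $\sigma$ with cycle-product in $c$. The modified type $\lambda$: $\lambda(c)=\rho(c)$ for $c\ne c^0$, and $\lambda(c^0)$ is obtained from $\rho(c^0)$ by subtracting 1 from every part (zeros discarded). $K_\lambda(n)\in\mathbb Z[\Gamma_n]$ is the sum of all elements of $\Gamma_n$ of modified type $\lambda$; it is nonzero iff $\|\lambda\|+\ell(\lambda(c^0))\le n$, and the nonzero ones form a $\mathbb Z$-basis of the center of $\mathbb Z[\Gamma_n]$. Write $K_\lambda(n)K_\mu(n)=\sum_\nu a_{\lambda\mu}^\nu(n)K_\nu(n)$. When $\|\nu\|=\|\lambda\|+\|\mu\|$, the number $a_{\lambda\mu}^\nu(n)$ is the same for all $n\ge\|\nu\|+\ell(\nu(c^0))$ and is denoted $a_{\lambda\mu}^\nu$. The Farahat–Higman ring $\mathcal G_\Gamma$ is the commutative ring with $\mathbb Z$-basis $(K_\lambda)_{\lambda\in\mathcal P(\Gamma_* )}$ and multiplication $K_\lambda K_\mu=\sum_{\|\nu\|=\|\lambda\|+\|\mu\|}a_{\lambda\mu}^\nu K_\nu$. *)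

(* Defs.v *)
From HB Require Import structures.
From mathcomp Require Import all_boot all_order all_fingroup all_algebra zify.
From mathcomp Require Export finmap.
From mathcomp.multinomials Require Export monalg.

Set Implicit Arguments.
Unset Strict Implicit.
Unset Printing Implicit Defensive.

Import GRing.Theory.

(* Partitions are weakly decreasing lists of positive integers, so that       *)
(* Leibniz equality is equality of multisets of parts.                        *)

Definition is_part (s : seq nat) := sorted geq s && (0 \notin s).

Record intpart := IntPart { parts :> seq nat; partsP : is_part parts }.

HB.instance Definition _ := [isSub for parts].
HB.instance Definition _ := [Countable of intpart by <:].

(* The partition whose parts are the nonzero entries of s. *)
Definition mkparts (s : seq nat) := sort geq [seq k <- s | 0 < k].

Fact geq_total : total geq.
Proof. by move=> m n; apply: leq_total. Qed.

Fact mkparts_subproof s : is_part (mkparts s).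
Proof.
by rewrite /is_part sort_sorted ?mem_sort ?mem_filter //; apply: geq_total.
Qed.

Definition mkpart s := IntPart (mkparts_subproof s).

Definition psize (p : intpart) := sumn p.
Definition plen (p : intpart) := size p.
Definition pmult (i : nat) (p : intpart) := count_mem i p.
Definition emptyp := mkpart [::].
Definition pcup (p q : intpart) := mkpart (p ++ q).
Definition pdiff (p q : intpart) := mkpart (foldr (fun i s => rem i s) p q).
Definition psub (p q : intpart) := all (fun i => pmult i p <= pmult i q) p.

(* Sub-multisets of the parts of p correspond to sublists of the sorted list  *)
(* p; repetitions are discarded (see mem_subparts and subparts_uniq).         *)
Definition subparts (p : intpart) : seq intpart :=
  undup [seq mkpart (mask (m : bitseq) p) | m : (size p).-tuple bool].

Section Types.

Variable gT : finGroupType.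

(* The group Gamma is the whole type gT. *)
Definition conjcl := {c : {set gT} | c \in classes [set: gT]}.

Fact conjcl1_subproof : [set 1%g] \in classes [set: gT].
Proof. by apply/imsetP; exists 1%g; rewrite ?inE ?class1G. Qed.

Definition conjcl1 : conjcl := Sub [set 1%g] conjcl1_subproof.

Definition ptype := {ffun conjcl -> intpart}.

Implicit Types l m : ptype.

Definition tnorm l := \sum_c psize (l c).
Definition tcup l m : ptype := [ffun c => pcup (l c) (m c)].
Definition tdiff l m : ptype := [ffun c => pdiff (l c) (m c)].
Definition tsupp (c : conjcl) (p : intpart) : ptype :=
  [ffun d => if d == c then p else emptyp].
Definition trow (k : nat) (c : conjcl) : ptype := tsupp c (mkpart [:: k]).

(* All parts of such an l are at most d and there are at most d of them at    *)
(* each class, which gives a finite list to search (mem_ptypes_of_norm).      *)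
Definition ptypes_of_norm (d : nat) : seq ptype :=
  undup [seq l <- [seq [ffun c => mkpart [seq val k | k <- t c]]
                  | t : {ffun conjcl -> d.-tuple 'I_d.+1}] | tnorm l == d].

End Types.

Section Wreath.

Variables (gT : finGroupType) (n : nat).

Record wreath := Wreath { wbase : {ffun 'I_n -> gT}; wperm : 'S_n }.

Definition wreath_pair x := (wbase x, wperm x).
Definition pair_wreath p := Wreath p.1 p.2.
Fact wreath_pairK : cancel wreath_pair pair_wreath. Proof. by case. Qed.

HB.instance Definition _ := Finite.copy wreath (can_type wreath_pairK).

Implicit Types (x y : wreath) (g : {ffun 'I_n -> gT}) (s : 'S_n).

Local Open Scope group_scope.

Definition wact s g : {ffun 'I_n -> gT} := [ffun i => g (s^-1 i)].

(* MathComp composes permutations from left to right, (t * s) i = s (t i):    *)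
(* the composite of s after t is written t * s.                               *)
Definition wmul x y : wreath :=
  Wreath [ffun i => wbase x i * wact (wperm x) (wbase y) i]
         (wperm y * wperm x).
Definition wone : wreath := Wreath [ffun=> 1] 1.
Definition winv x : wreath :=
  Wreath (wact (wperm x)^-1 [ffun i => (wbase x i)^-1]) (wperm x)^-1.

Fact wmulA : associative wmul.
Proof.
move=> [g s] [h t] [k u]; rewrite /wmul /wact /= mulgA; congr Wreath.
by apply/ffunP=> i; rewrite !ffunE /= invMg permM mulgA.
Qed.

Fact wmul1 : left_id wone wmul.
Proof.
move=> [h t]; rewrite /wmul /wact /= mulg1; congr Wreath.
by apply/ffunP=> i; rewrite !ffunE /= invg1 perm1 mul1g.
Qed.

Fact wmulr1 : right_id wone wmul.
Proof.
move=> [h t]; rewrite /wmul /wact /= mul1g; congr Wreath.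
by apply/ffunP=> i; rewrite !ffunE /= mulg1.
Qed.

Fact wmulV : left_inverse wone winv wmul.
Proof.
move=> [h t]; rewrite /wmul /winv /wone /wact /= mulgV; congr Wreath.
by apply/ffunP=> i; rewrite !ffunE /= mulVg.
Qed.

Fact wmulrV : right_inverse wone winv wmul.
Proof.
move=> [h t]; rewrite /wmul /winv /wone /wact /= mulVg; congr Wreath.
by apply/ffunP=> i; rewrite !ffunE /= invgK permKV mulgV.
Qed.

HB.instance Definition _ :=
  isGroup.Build wreath wmulA wmul1 wmulr1 wmulV wmulrV.

(* For the cycle (i_1 ... i_k) of the permutation with i_1 = i, this is       *)
(* g_(i_k) ... g_(i_1).                                                       *)
Definition cycprod x (i : 'I_n) : gT :=
  \prod_(j <- rev (traject (wperm x) i #|porbit (wperm x) i|)) wbase x j.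

(* The cycles of the permutation of x whose cycle-products lie in c; the      *)
(* choice of the starting point i in C is immaterial as c is a conjugacy      *)
(* class.                                                                     *)
Definition cycles_in x (c : conjcl gT) : {set {set 'I_n}} :=
  [set C in porbits (wperm x) | [exists i in C, cycprod x i \in val c]].

Definition wtype x : ptype gT :=
  [ffun c => mkpart [seq #|C| | C : {set 'I_n} in cycles_in x c]].

Definition mtype x : ptype gT :=
  [ffun c => if c == conjcl1 gT then mkpart [seq k.-1 | k <- wtype x c]
             else wtype x c].

End Wreath.

(* The integral group ring of a finite group G: functions G -> int with the   *)
(* convolution product (not the pointwise ring structure of {ffun G -> int}). *)

Definition gring_mul (gT : finGroupType) (f h : {ffun gT -> int}) :
  {ffun gT -> int} := [ffun z => \sum_x f x * h (x^-1 * z)%g]%R.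

Section FarahatHigman.

Variable gT : finGroupType.
Implicit Types l m u : ptype gT.

Definition Kn (n : nat) l : {ffun wreath gT n -> int} :=
  [ffun x => (mtype x == l)%:R%R].

(* The functions Kn n u have pairwise disjoint supports, so the coefficient   *)
(* of a nonzero Kn n u in an expansion in this family is the value at any     *)
(* element of modified type u. That the product does expand is Kn_expansion.  *)
Definition Kcoef (n : nat) l m u : int :=
  if [pick z : wreath gT n | mtype z == u] is Some z
  then gring_mul (Kn n l) (Kn n m) z else 0%R.

Definition stable_bound u := tnorm u + plen (u (conjcl1 gT)).

(* When tnorm u = tnorm l + tnorm m, Kcoef n l m u does not depend on         *)
(* n >= stable_bound u.                                                       *)
Definition FHcoef l m u : int := Kcoef (stable_bound u) l m u.

Local Open Scope ring_scope.

(* The Farahat-Higman ring, as the free Z-module on modified types; FHmul is  *)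
(* the bilinear extension of FHmulK (see FHmul_basis and FHmulK_coef).        *)
Definition FH := {malg int[ptype gT]}.

Definition FHK l : FH := << l >>.

Definition FHmulK l m : FH :=
  \sum_(u <- ptypes_of_norm gT (tnorm l + tnorm m)) FHcoef l m u *: FHK u.

Definition FHmul (a b : FH) : FH :=
  \sum_(l <- msupp a) \sum_(m <- msupp b) (a@_l * b@_m) *: FHmulK l m.

End FarahatHigman.

Lemma pmult0 (p : intpart) : pmult 0 p = 0.
Proof. by have /andP[_ /count_memPn] := partsP p. Qed.

Lemma pmult_mkpart i s : 0 < i -> pmult i (mkpart s) = count_mem i s.
Proof.
move=> i_gt0; rewrite /pmult /= /mkparts count_sort count_filter.
by apply: eq_count => k /=; case: eqP => // ->; rewrite i_gt0.
Qed.

Lemma eq_intpart (p q : intpart) :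
  (forall i, 0 < i -> pmult i p = pmult i q) -> p = q.
Proof.
move=> eq_pq; apply/val_inj/(sorted_eq (leT := geq)).
- by move=> a b d /= /[swap]; apply: leq_trans.
- by move=> a b /= /andP[ba ab]; apply/eqP; rewrite eqn_leq ba ab.
- by have /andP[] := partsP p.
- by have /andP[] := partsP q.
apply/allP=> i _; apply/eqP; case: i => [|i]; last exact: eq_pq.
exact: etrans (pmult0 p) (esym (pmult0 q)).
Qed.

Lemma mkpart_id (p : intpart) : mkpart p = p.
Proof. by apply: eq_intpart => i i_gt0; rewrite pmult_mkpart. Qed.

Lemma pmult_pcup i p q : pmult i (pcup p q) = pmult i p + pmult i q.
Proof.
by case: i => [|i]; rewrite ?pmult0 // pmult_mkpart // count_cat.
Qed.

Lemma pmult_pdiff i p q : pmult i (pdiff p q) = pmult i p - pmult i q.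
Proof.
case: i => [|i]; rewrite ?pmult0 // pmult_mkpart // /pmult.
elim: {q}(parts q) => [|k s IHs] /=; first by rewrite subn0.
by rewrite count_mem_rem IHs addnC subnDA.
Qed.

Lemma psubP p q : reflect (forall i, pmult i p <= pmult i q) (psub p q).
Proof.
apply: (iffP allP) => [sub_pq i|sub_pq i _]; last exact: sub_pq.
have [/sub_pq//|/count_memPn] := boolP (i \in parts p).
by rewrite /pmult => ->.
Qed.

Lemma subparts_uniq p : uniq (subparts p).
Proof. exact: undup_uniq. Qed.

Lemma mem_subparts p q : (q \in subparts p) = psub q p.
Proof.
rewrite mem_undup; apply/imageP/psubP=> [[m _ ->] [|i]|sub_qp].
- by rewrite !pmult0.
- by rewrite pmult_mkpart //; apply/leq_count_subseq/mask_subseq.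
have /subseqP[m sz_m def_q] : subseq q p.
  have s_q := partsP q; have s_p := partsP p.
  move: s_q s_p sub_qp; rewrite /is_part /pmult.
  move=> /andP[sq _] /andP[sp _].
  elim: (parts p) (parts q) sp sq => [|k s IHs] [|i t] //= sp sq le_ts.
    by have := le_ts i; rewrite eqxx.
  have [eq_ik|neq_ik] := eqVneq i k.
    apply: IHs; [exact: path_sorted sp | exact: path_sorted sq |].
    by move=> j; have := le_ts j; rewrite eq_ik leq_add2l.
  have lt_ik : i < k.
    have : i \in k :: s by rewrite -has_pred1 has_count (leq_trans _ (le_ts i)) //= eqxx.
    rewrite inE (negPf neq_ik) /= => i_s.
    have /allP/(_ i i_s)/= : all (geq k) s.
      by apply: order_path_min sp => a b d /= /[swap]; apply: leq_trans.
    by rewrite ltn_neqAle neq_ik.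
  apply: IHs => [||j]; [exact: path_sorted sp | done |].
  have := le_ts j; rewrite /=; case: (k =P j) => [<- _|//].
  rewrite -/(count_mem k (i :: t)) (_ : count_mem k (i :: t) = 0) //.
  apply/count_memPn; rewrite inE (gtn_eqF lt_ik) /=.
  apply/negP=> k_t.
  have /allP/(_ k k_t)/= : all (geq i) t.
    by apply: order_path_min sq => a b d /= /[swap]; apply: leq_trans.
  by rewrite leqNgt lt_ik.
exists (Tuple (introT eqP sz_m)) => //=.
by rewrite -{1}(mkpart_id q) {1}def_q.
Qed.

Lemma leq_part_psize i (p : intpart) : i \in parts p -> i <= psize p.
Proof.
rewrite /psize; elim: (parts p) => //= k s IHs; rewrite inE.
by case/predU1P=> [->|/IHs]; lia.
Qed.

Lemma plen_le_psize p : plen p <= psize p.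
Proof.
have /andP[_] := partsP p; rewrite /plen /psize.
elim: (parts p) => //= k s IHs; rewrite inE negb_or => /andP[k0 /IHs].
by move: k0; lia.
Qed.

Lemma psize_mkpart s : psize (mkpart s) = sumn s.
Proof.
rewrite /psize /= /mkparts (perm_sumn (permEl (perm_sort _ _))).
by elim: s => //= -[|k] s /= ->.
Qed.

Lemma psize_pmult p N : psize p <= N ->
  psize p = \sum_(1 <= i < N.+1) i * pmult i p.
Proof.
move=> le_pN; have: all (fun i => 0 < i <= N) p.
  apply/allP=> i ip; rewrite (leq_trans (leq_part_psize ip)) // andbT lt0n.
  by apply: contraNneq (proj2 (andP (partsP p))) => <-.
rewrite /psize /pmult; elim: (parts p) => [|k s IHs] /=.
  by rewrite big1 // => i _; rewrite muln0.
case/andP=> /andP[k_gt0 k_le] /IHs->. under [RHS]eq_bigr do rewrite mulnDr.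
rewrite big_split /=; congr addn.
rewrite (bigD1_seq k) ?iota_uniq ?mem_index_iota ?k_gt0 //= eqxx muln1.
by rewrite big1 ?addn0 // => i nik; rewrite eq_sym (negPf nik) muln0.
Qed.

Lemma plen_pmult p N : psize p <= N ->
  plen p = \sum_(1 <= i < N.+1) pmult i p.
Proof.
move=> le_pN; have: all (fun i => 0 < i <= N) p.
  apply/allP=> i ip; rewrite (leq_trans (leq_part_psize ip)) // andbT lt0n.
  by apply: contraNneq (proj2 (andP (partsP p))) => <-.
rewrite /plen /pmult; elim: (parts p) => [|k s IHs] /=.
  by rewrite big1.
case/andP=> /andP[k_gt0 k_le] /IHs->.
rewrite big_split /= -add1n; congr addn.
rewrite (bigD1_seq k) ?iota_uniq ?mem_index_iota ?k_gt0 //= eqxx.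
by rewrite big1 ?addn0 // => i nik; rewrite eq_sym (negPf nik).
Qed.

Lemma fact_add_dvd a b : a`! * b`! %| (a + b)`!.
Proof. by rewrite -(@bin_fact (a + b) a) ?leq_addr // addKn dvdn_mull. Qed.

Lemma prod_fact_dvd (I : eqType) (s : seq I) (F : I -> nat) :
  \prod_(i <- s) (F i)`! %| (\sum_(i <- s) F i)`!.
Proof.
elim: s => [|i s IHs]; rewrite ?big_nil // !big_cons.
exact: dvdn_trans (dvdn_mul (dvdnn _) IHs) (fact_add_dvd _ _).
Qed.

Lemma prod_fact_pred_dvd (I : eqType) (s : seq I) (F : I -> nat) i :
  uniq s -> i \in s -> 
  \prod_(j <- s) (F j)`! %| F i * (\sum_(j <- s) F j).-1`!.
Proof.
move=> s_uniq si; rewrite !(bigD1_seq i) //=.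
case: (F i) => [|k]; first by rewrite mul0n dvdn0.
rewrite factS -mulnA addSn /= dvdn_pmul2l //.
apply: dvdn_trans (dvdn_mul (dvdnn _) _) (fact_add_dvd _ _).
by rewrite -big_filter -[X in _ %| X`!]big_filter prod_fact_dvd.
Qed.

(* The coefficients (psize p + r) (r - 1)! / ((r - plen p)! prod_i m_i(p)!)   *)
(* are integers, so writing them with %/ loses nothing.                       *)
Lemma coef_dvd (p : intpart) r : plen p <= r ->
  (r - plen p)`! * \prod_(1 <= i < (psize p).+1) (pmult i p)`!
    %| (psize p + r) * (r - 1)`!.
Proof.
move=> le_pr; set N := psize p.
pose F i := if i is 0 then r - plen p else pmult i p.
have F1 i : i \in index_iota 1 N.+1 -> F i = pmult i p.
  by rewrite mem_index_iota; case: i.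
have sumF : \sum_(0 <= i < N.+1) F i = r.
  rewrite big_ltn //= (eq_big_seq _ F1) -plen_pmult //= subnK //.
have -> : (r - plen p)`! * \prod_(1 <= i < N.+1) (pmult i p)`!
    = \prod_(0 <= i < N.+1) (F i)`!.
  by rewrite [RHS]big_ltn //=; congr muln; apply: eq_big_seq => i /F1->.
have dvdF i : i < N.+1 -> 
    \prod_(0 <= i < N.+1) (F i)`! %| F i * (r - 1)`!.
  move=> ltiN; rewrite subn1 -sumF; apply: prod_fact_pred_dvd.
    exact: iota_uniq.
  by rewrite mem_index_iota.
have -> : N + r = \sum_(0 <= i < N.+1) i.+1 * F i.
  under eq_bigr do rewrite mulSn; rewrite big_split /= sumF addnC; congr addn.
  by rewrite [RHS]big_ltn // mul0n add0n [LHS](psize_pmult (leqnn _)); apply: eq_big_seq => i /F1->.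
rewrite big_distrl /= [X in _ %| X]big_seq; apply: dvdn_sum => i.
by rewrite mem_index_iota => /andP[_ ltiN]; rewrite -mulnA dvdn_mull ?dvdF.
Qed.

Lemma mem_ptypes_of_norm (gT : finGroupType) d (l : ptype gT) :
  (l \in ptypes_of_norm gT d) = (tnorm l == d).
Proof.
rewrite mem_undup mem_filter; case: eqP => //= norm_l.
have le_ld c : psize (l c) <= d by rewrite -norm_l /tnorm (bigD1 c) ?leq_addr.
apply/imageP; exists [ffun c => mktuple (fun i : 'I_d => inord (nth 0 (l c) i))] => //.
apply/ffunP=> c; rewrite !ffunE; apply: eq_intpart => i i_gt0.
rewrite pmult_mkpart // /pmult.
have {norm_l} := le_ld c; have := plen_le_psize (l c).
move: (@leq_part_psize^~ (l c)); set s := parts (l c); set N := psize _.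
rewrite /plen -/s => le_sN le_szN le_Nd.
have -> : [seq val k | k <- mktuple (fun j : 'I_d => inord (nth 0 s j) : 'I_d.+1)]
   = [seq nth 0 s j | j <- iota 0 d].
  rewrite -map_comp -val_enum_ord -map_comp; apply: eq_map => j /=.
  rewrite inordK // ltnS; have [lt_js|le_sj] := ltnP j (size s).
    by rewrite (leq_trans (le_sN _ _) le_Nd) // mem_nth.
  by rewrite nth_default.
rewrite -(subnKC (leq_trans le_szN le_Nd)) iotaD map_cat count_cat -/(mkseq _ _) mkseq_nth.
rewrite [X in _ + X](_ : _ = 0) ?addn0 //.
apply/eqP; rewrite eqn0Ngt -has_count -all_predC; apply/allP=> k /mapP[j].
rewrite mem_iota add0n => /andP[le_sj _] ->; rewrite nth_default //=.
by rewrite neq_ltn i_gt0.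
Qed.

Lemma key_matching (T : finType) (K : eqType) (A B : {set T}) (f g : T -> K) :
    (forall k, #|[set a in A | f a == k]| = #|[set b in B | g b == k]|) ->
  exists h : T -> T, {in A, forall a, h a \in B /\ g (h a) = f a}
                  /\ {in A &, injective h}.
Proof.
move=> eqAB; pose As a := enum [set a' in A | f a' == f a].
pose Bs a := enum [set b in B | g b == f a].
have szAB a : size (As a) = size (Bs a) by rewrite -!cardE eqAB.
have A_As a : a \in A -> a \in As a by move=> Aa; rewrite mem_enum inE Aa /=.
pose h a := nth a (Bs a) (index a (As a)).
have hP a : a \in A -> h a \in B /\ g (h a) = f a.
  move=> Aa; have: h a \in Bs a by rewrite mem_nth // -szAB index_mem A_As.
  by rewrite mem_enum inE => /andP[-> /eqP].
exists h; split=> // a a' Aa Aa' eq_h.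
have eq_f : f a = f a' by rewrite -(hP a Aa).2 -(hP a' Aa').2 eq_h.
have eqAs : As a' = As a by rewrite /As eq_f.
have eqBs : Bs a' = Bs a by rewrite /Bs eq_f.
have lt_i b : b \in As a -> index b (As a) < size (Bs a).
  by rewrite -szAB index_mem.
have As_a := A_As a Aa; have := A_As a' Aa'; rewrite eqAs => As_a'.
move/eqP: eq_h; rewrite /h eqAs eqBs (set_nth_default a' a) ?lt_i //.
rewrite nth_uniq ?lt_i ?enum_uniq // => /eqP eq_i.
by rewrite -(nth_index a As_a) eq_i nth_index.
Qed.

Section ConjugacyInWreath.

Variables (gT : finGroupType) (n : nat).
Implicit Types (x y z w : wreath gT n) (c : conjcl gT) (i j : 'I_n).

Local Open Scope group_scope.

Lemma wbaseM x y i : wbase (x * y) i = wbase x i * wbase y ((wperm x)^-1 i).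
Proof. by rewrite /= !ffunE. Qed.

Lemma wpermM x y i : wperm (x * y) i = wperm x (wperm y i).
Proof. by rewrite /= permM. Qed.

Lemma eq_wreath x y : wbase x =1 wbase y -> wperm x =1 wperm y -> x = y.
Proof. by case: x y => [g s] [h t] /= /ffunP-> /permP->. Qed.

Definition clof (a : gT) : conjcl gT :=
  Sub (a ^: [set: gT]) (mem_classes (in_setT a)).

Lemma clofP a c : (a \in val c) = (clof a == c).
Proof.
apply/idP/eqP=> [ac|<-]; last exact: class_refl.
apply: val_inj; have /imsetP[b _ def_c] := valP c; rewrite /= def_c.
by apply/class_eqP; rewrite -def_c.
Qed.

Lemma clof_eq a b : clof a = clof b -> exists d, b = d * a * d^-1.
Proof.
move/(congr1 val)=> /= eq_ab; have: b \in a ^: [set: gT].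
  by rewrite eq_ab class_refl.
by case/imsetP=> d _ ->; exists d^-1; rewrite invgK conjgE mulgA.
Qed.

Lemma clof_conj a d : clof (d * a * d^-1) = clof a.
Proof.
apply: val_inj => /=; apply/class_eqP/imsetP; exists d^-1; rewrite ?inE //.
by rewrite conjgE invgK mulgA.
Qed.

Definition cpart x i k : gT :=
  \prod_(j <- rev (traject (wperm x) i k)) wbase x j.

Lemma cpart0 x i : cpart x i 0 = 1.
Proof. by rewrite /cpart big_nil. Qed.

Lemma cpartSr x i k :
  cpart x i k.+1 = wbase x (iter k (wperm x) i) * cpart x i k.
Proof. by rewrite /cpart trajectSr rev_rcons big_cons. Qed.

Lemma cpartS x i k : cpart x i k.+1 = cpart x (wperm x i) k * wbase x i.
Proof. by rewrite /cpart trajectS rev_cons -cats1 big_cat big_seq1. Qed.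

Lemma porbit_step (s : 'S_n) i : porbit s (s i) = porbit s i.
Proof. by have := porbit_perm s 1 i; rewrite expg1. Qed.

Lemma cycprod_step x i : clof (cycprod x (wperm x i)) = clof (cycprod x i).
Proof.
rewrite -(clof_conj (cycprod x i) (wbase x i)); congr clof.
rewrite /cycprod porbit_step; set k := #|_|.
rewrite -/(cpart x i k) -/(cpart x (wperm x i) k).
apply: (mulIg (wbase x i)); rewrite -cpartS cpartSr iter_porbit mulgKV //.
Qed.

Lemma cycprod_porbit x i j :
  j \in porbit (wperm x) i -> clof (cycprod x j) = clof (cycprod x i).
Proof.
case/porbitP=> k ->; rewrite permX.
by elim: k => //= k <-; rewrite cycprod_step.
Qed.

Lemma mem_cycles_in x c i :
  (porbit (wperm x) i \in cycles_in x c) = (clof (cycprod x i) == c).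
Proof.
rewrite inE imset_f ?inE //=; apply/exists_inP/idP=> [[j ji]|clc].
  by rewrite clofP (cycprod_porbit ji).
by exists i; rewrite ?porbit_id // clofP.
Qed.

Lemma cycles_inP x c C : reflect
  (exists2 i, C = porbit (wperm x) i & clof (cycprod x i) = c)
  (C \in cycles_in x c).
Proof.
apply: (iffP idP) => [Cc|[i -> <-]]; last by rewrite mem_cycles_in.
have: C \in porbits (wperm x) by move: Cc; rewrite inE => /andP[].
case/imsetP=> i _ defC; exists i; rewrite //; apply/eqP.
by rewrite -mem_cycles_in -defC.
Qed.

Lemma pmult_wtype x c k : 0 < k ->
  pmult k (wtype x c) = #|[set C in cycles_in x c | #|C| == k]|.
Proof.
move=> k_gt0; rewrite ffunE pmult_mkpart // count_map -size_filter cardE.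
by rewrite /enum_mem -filter_predI; congr size; apply: eq_filter => C; rewrite !inE andbC.
Qed.

Section Intertwine.
Variables (x y : wreath gT n) (p : 'S_n) (E : 'I_n -> gT).
Hypothesis perm_p : forall j, wperm y (p j) = p (wperm x j).
Hypothesis base_E :
  forall j, wbase y (p j) * E j = E (wperm x j) * wbase x j.

Lemma iter_intertwine k j : iter k (wperm y) (p j) = p (iter k (wperm x) j).
Proof. by elim: k => //= k ->. Qed.

Lemma cpart_intertwine k j :
  cpart y (p j) k * E j = E (iter k (wperm x) j) * cpart x j k.
Proof.
elim: k => [|k IHk]; first by rewrite !cpart0 mul1g mulg1.
by rewrite !cpartSr -mulgA IHk mulgA iter_intertwine base_E mulgA.
Qed.

Lemma porbit_intertwine j : porbit (wperm y) (p j) = p @: porbit (wperm x) j.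
Proof.
apply/setP=> i; apply/porbitP/imsetP=> [[k ->]|[j' /porbitP[k ->] ->]].
  by exists ((wperm x ^+ k) j); rewrite ?mem_porbit // !permX iter_intertwine.
by exists k; rewrite !permX iter_intertwine.
Qed.

Lemma cycprod_intertwine j :
  clof (cycprod y (p j)) = clof (cycprod x j).
Proof.
rewrite -(clof_conj (cycprod x j) (E j)); congr clof.
apply: (mulIg (E j)); rewrite /cycprod porbit_intertwine card_imset; last exact: perm_inj.
set k := #|_|; rewrite -/(cpart x j k) -/(cpart y (p j) k).
by rewrite cpart_intertwine iter_porbit mulgKV.
Qed.

Lemma leq_pmult_intertwine c k : 0 < k ->
  pmult k (wtype x c) <= pmult k (wtype y c).
Proof.
move=> k_gt0; rewrite !pmult_wtype //.
have im_inj : injective (fun C : {set 'I_n} => p @: C).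
  by apply: imset_inj; apply: perm_inj.
rewrite -(card_imset _ im_inj); apply/subset_leq_card/subsetP=> _ /imsetP[C + ->].
rewrite inE => /andP[/cycles_inP[i -> cl_i] szC].
rewrite inE card_imset ?szC ?andbT; last exact: perm_inj.
by rewrite -porbit_intertwine mem_cycles_in cycprod_intertwine cl_i.
Qed.

Lemma intertwine_conj : exists w, y * w = w * x.
Proof.
exists (Wreath [ffun i => E (wperm x (p^-1 i))] p); apply: eq_wreath => i.
  rewrite !wbaseM /= !ffunE.
  rewrite -(permKV p i) permK; move: (p^-1 i) => {i} j.
  have -> : (wperm y)^-1 (p j) = p ((wperm x)^-1 j).
    by apply: (@perm_inj _ (wperm y)); rewrite permKV perm_p permKV.
  by rewrite permK permKV base_E.
by rewrite !wpermM /= perm_p.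
Qed.

End Intertwine.

Lemma wtype_conj w x : wtype (w * x * w^-1) = wtype x.
Proof.
suff le_wx (v u : wreath gT n) k c : 0 < k -> pmult k (wtype u c) <= pmult k (wtype (v * u * v^-1) c).
  apply/ffunP=> c; apply: eq_intpart => k k_gt0; apply/eqP.
  have defx : w^-1 * (w * x * w^-1) * w^-1^-1 = x.
    by rewrite invgK !mulgA mulVg mul1g mulgKV.
  rewrite eqn_leq; apply/andP; split; last exact: le_wx.
  by have := le_wx w^-1 (w * x * w^-1) k c k_gt0; rewrite defx.
move=> k_gt0; set y := v * u * v^-1.
have eq_yv : y * v = v * u by rewrite mulgKV.
have p_yv j : wperm y (wperm v j) = wperm v (wperm u j).
  by rewrite -!wpermM eq_yv.
apply: (@leq_pmult_intertwine _ _ (wperm v) (fun j => wbase v (wperm v ((wperm u)^-1 j)))) => // j.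
rewrite permK; have := wbaseM y v (wperm v j); rewrite eq_yv wbaseM permK => ->.
congr (_ * wbase v _); apply: (@perm_inj _ (wperm y)).
by rewrite permKV p_yv permKV.
Qed.

Definition croot (s : 'S_n) i := odflt i [pick j in porbit s i].

Lemma mem_croot s i : croot s i \in porbit s i.
Proof. by rewrite /croot; case: pickP => // /(_ i); rewrite porbit_id. Qed.

Lemma croot_eq s i j : porbit s i = porbit s j -> croot s i = croot s j.
Proof.
move=> eq_ij; rewrite /croot eq_ij.
by case: pickP => // /(_ j); rewrite porbit_id.
Qed.

Lemma porbit_croot s i : porbit s (croot s i) = porbit s i.
Proof. by apply/eqP; rewrite eq_porbit_mem mem_croot. Qed.

Lemma crootK s i : croot s (croot s i) = croot s i.
Proof. by apply: croot_eq; rewrite porbit_croot. Qed.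

Lemma wtype_roots x k c : 0 < k ->
  pmult k (wtype x c) = #|[set i in [set i | croot (wperm x) i == i]
     | (#|porbit (wperm x) i|, clof (cycprod x i)) == (k, c)]|.
Proof.
move=> k_gt0; rewrite pmult_wtype //; set A := (X in _ = #|pred_of_set X|).
have injA : {in A &, injective (porbit (wperm x))}.
  move=> i j; rewrite !inE => /andP[/eqP ri _] /andP[/eqP rj _] /croot_eq.
  by rewrite ri rj.
rewrite -(card_in_imset injA); apply: eq_card => C.
rewrite inE; apply/andP/imsetP=> [[/cycles_inP[i -> cl_i] sz_i]|[i]].
  exists (croot (wperm x) i); rewrite ?porbit_croot //.
  by rewrite !inE crootK eqxx porbit_croot xpair_eqE sz_i (cycprod_porbit (mem_croot _ _)) cl_i /=.
by move=> + ->; rewrite mem_cycles_in !inE xpair_eqE => /and3P[_ -> ->].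
Qed.

Lemma eq_iter_porbit (s : 'S_n) r (i j : nat) : i < #|porbit s r| -> j < #|porbit s r| ->
  iter i s r = iter j s r -> i = j.
Proof.
move=> lt_i lt_j; rewrite -(nth_traject s lt_i r) -(nth_traject s lt_j r) => /eqP.
by rewrite nth_uniq ?size_traject ?uniq_traject_porbit // => /eqP.
Qed.

Lemma wtype_eq_conj x y : wtype x = wtype y -> exists w, y = w * x * w^-1.
Proof.
move=> eq_xy; suff [w eq_w]: exists w, y * w = w * x.
  by exists w; rewrite -eq_w mulgK.
set s := wperm x; set t := wperm y.
pose key z i := (#|porbit (wperm z) i|, clof (cycprod z i)).
pose rts z := [set i | croot (wperm z) i == i].
have porbit_gt0 (u : 'S_n) i : 0 < #|porbit u i| by rewrite lt0n card_porbit_neq0.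
have eq_keys kc : #|[set a in rts x | key x a == kc]| = #|[set b in rts y | key y b == kc]|.
  case: kc => -[|k] c; last by rewrite -!wtype_roots // eq_xy.
  transitivity 0; last apply: esym; apply: eq_card0 => i; rewrite !inE xpair_eqE.
    by rewrite gtn_eqF ?andbF.
  by rewrite gtn_eqF ?andbF.
have [h [hP h_inj]] := key_matching eq_keys.
have rootP i : croot s i \in rts x by rewrite inE crootK.
have card_h i : #|porbit t (h (croot s i))| = #|porbit s i|.
  by have [_ [->]] := hP _ (rootP i); rewrite porbit_croot.
pose k i := index i (traject s (croot s i) #|porbit s i|).
have kP i : k i < #|porbit s i| /\ iter (k i) s (croot s i) = i.
  have i_tr : i \in traject s (croot s i) #|porbit s i|.
    by rewrite -porbit_croot -porbit_traject porbit_sym mem_croot.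
  have lt_k : k i < #|porbit s i|.
    by rewrite -[X in _ < X](size_traject s (croot s i)) index_mem.
  by split=> //; rewrite -(nth_traject s lt_k) nth_index.
pose p0 i := iter (k i) t (h (croot s i)).
have p0_inj : injective p0.
  move=> i j eq_p.
  have eq_r : croot s i = croot s j.
    have [] := hP _ (rootP i); have [] := hP _ (rootP j).
    rewrite !inE => /eqP rj _ /eqP ri _; apply: h_inj => //.
    rewrite -ri -rj; apply: croot_eq.
    rewrite -(porbit_perm t (k i)) -[RHS](porbit_perm t (k j)) !permX.
    by congr porbit.
  have eq_C : porbit s i = porbit s j by rewrite -porbit_croot eq_r porbit_croot.
  have [lt_i <-] := kP i; have [lt_j <-] := kP j; rewrite eq_r.
  congr iter; move: eq_p; rewrite /p0 eq_r; apply: eq_iter_porbit.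
    by rewrite card_h -eq_C.
  by rewrite card_h.
have ksucc i : (k (s i) = (k i).+1)
    \/ [/\ k (s i) = 0 & (k i).+1 = #|porbit s i|].
  have [lt_i def_i] := kP i; have [] := kP (s i).
  have -> : croot s (s i) = croot s i by apply: croot_eq; rewrite porbit_step.
  rewrite porbit_step => lt_si eq_i.
  have eq_si : iter (k (s i)) s (croot s i) = iter (k i).+1 s (croot s i).
    by rewrite eq_i iterS def_i.
  have [lt_k|] := ltnP (k i).+1 #|porbit s i|.
    by left; apply: (@eq_iter_porbit s (croot s i)); rewrite ?porbit_croot.
  move=> le_k; have eq_k : (k i).+1 = #|porbit s i| by apply/eqP; rewrite eqn_leq lt_i.
  right; split=> //; apply: (@eq_iter_porbit s (croot s i)); rewrite ?porbit_croot //.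
  by rewrite eq_si eq_k -(porbit_croot s i) iter_porbit.
have /fin_all_exists[d dP] i : exists e : gT, i \in rts x ->
    cycprod y (h i) = e * cycprod x i * e^-1.
  have [ri|] := boolP (i \in rts x); last by exists 1.
  have eq_cl : clof (cycprod y (h i)) = clof (cycprod x i) by case: (hP i ri) => _ /(congr1 snd).
  have [e eq_e] := clof_eq (esym eq_cl).
  by exists e.
pose E i := let r := croot s i in cpart y (h r) (k i) * d r * (cpart x r (k i))^-1.
have croot_step i : croot s (s i) = croot s i.
  by apply: croot_eq; rewrite porbit_step.
apply: (@intertwine_conj x y (perm p0_inj) E) => i; rewrite !permE -/s -/t.
  rewrite /p0 croot_step; case: (ksucc i) => [->//|[-> eq_k]].
  by rewrite -iterS eq_k -card_h iter_porbit.
have [_ def_i] := kP i.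
have -> : wbase y (p0 i) * E i =
   cpart y (h (croot s i)) (k i).+1 * d (croot s i) * (cpart x (croot s i) (k i))^-1.
  by rewrite /E cpartSr !mulgA.
apply: (mulIg (cpart x (croot s i) (k i))); rewrite mulgKV -[RHS]mulgA.
have -> : wbase x i * cpart x (croot s i) (k i) = cpart x (croot s i) (k i).+1.
  by rewrite cpartSr -/s def_i.
rewrite /E croot_step; case: (ksucc i) => [->|[-> eq_k]].
  by rewrite mulgKV.
rewrite !cpart0 invg1 mulg1 mul1g eq_k -{1}card_h -(porbit_croot s i).
by rewrite -[cpart x _ _]/(cycprod x _) -[cpart y _ _]/(cycprod y _) dP // mulgKV.
Qed.

Lemma tnorm_wtype x : tnorm (wtype x) = n.
Proof.
have -> : tnorm (wtype x) = \sum_c \sum_(C in cycles_in x c) #|C|.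
  by apply: eq_bigr => c _; rewrite ffunE psize_mkpart sumnE big_map big_enum.
rewrite (exchange_big_dep (mem (porbits (wperm x)))) /=; last first.
  by move=> c C _; rewrite inE => /andP[].
transitivity (\sum_(C in porbits (wperm x)) #|C|).
  apply: eq_bigr => _ /imsetP[i _ ->].
  rewrite (bigD1 (clof (cycprod x i))) ?mem_cycles_in //= big1 ?addn0 // => c.
  by rewrite mem_cycles_in eq_sym andbC; case: eqP.
rewrite -[RHS]card_ord -sum1_card (partition_big_imset (porbit (wperm x))) /=.
apply: eq_bigr => _ /imsetP[i _ ->]; rewrite -sum1_card; apply: eq_bigl => j.
by rewrite eq_porbit_mem.
Qed.

Lemma mtype_inj x y : mtype x = mtype y -> wtype x = wtype y.
Proof.
move/ffunP=> eq_xy; set c0 := conjcl1 gT.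
have eq_c c : c != c0 -> wtype x c = wtype y c.
  by move=> nc; have := eq_xy c; rewrite !ffunE (negPf nc).
have eq_k k : 1 < k -> pmult k (wtype x c0) = pmult k (wtype y c0).
  case: k => [|[|k]] // _.
  have mtypeE z : pmult k.+1 (mtype z c0) = pmult k.+2 (wtype z c0).
    by rewrite /mtype ffunE eqxx pmult_mkpart // count_map; apply: eq_count; case.
  by rewrite -!mtypeE eq_xy.
have eq_sz : psize (wtype x c0) = psize (wtype y c0).
  have tn z : (psize (wtype z c0) + \sum_(c | c != c0) psize (wtype z c))%N = n.
    by rewrite -[RHS](tnorm_wtype z) /tnorm [RHS](bigD1 c0).
  apply: (@addIn (\sum_(c | c != c0) psize (wtype x c))); rewrite tn -[LHS](tn y).
  by congr addn; apply: eq_bigr => c /eq_c->.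
apply/ffunP=> c; have [->|/eq_c//] := eqVneq c c0.
apply: eq_intpart => -[|[|k]] // _; last exact: eq_k.
have := eq_sz; set N := (psize (wtype y c0)).+1.
rewrite (@psize_pmult (wtype x c0) N) ?eq_sz //.
rewrite (@psize_pmult (wtype y c0) N) //.
rewrite !(big_ltn (m := 1)) // !mul1n => /eqP.
rewrite [X in _ + X](eq_big_nat _ _ (F2 := fun b => (b * pmult b (wtype y c0))%N)).
  by rewrite eqn_add2r => /eqP.
by move=> b /andP[b_gt1 _]; rewrite eq_k.
Qed.

Lemma mtype_conj w x : mtype (w * x * w^-1) = mtype x.
Proof. by rewrite /mtype wtype_conj. Qed.

Lemma mtype_eq_conj x y : mtype x = mtype y -> exists w, y = w * x * w^-1.
Proof. by move/mtype_inj/wtype_eq_conj. Qed.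

Lemma Kn_expansion (l m : ptype gT) : (gring_mul (Kn n l) (Kn n m) =
  \sum_(u <- undup [seq mtype z | z : wreath gT n]) Kn n u *~ Kcoef n l m u)%R.
Proof.
have z_in (z : wreath gT n) : mtype z \in undup [seq mtype z | z : wreath gT n].
  by rewrite mem_undup; apply/imageP; exists z.
apply/ffunP=> z; rewrite sum_ffunE (bigD1_seq (mtype z)) ?z_in ?undup_uniq //=.
rewrite big1 ?addr0 => [|u nu]; last first.
  by rewrite ffunMzE ffunE eq_sym (negPf nu) mul0rz.
rewrite ffunMzE [Kn n _ z]ffunE eqxx /Kcoef intz; case: pickP => [y /eqP eq_yz|/(_ z)]; last by rewrite eqxx.
have [w ->] := mtype_eq_conj (esym eq_yz).
have KnJ k v : Kn n k (v ^ w^-1) = Kn n k v.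
  by rewrite [LHS]ffunE [RHS]ffunE conjgE invgK mulgA mtype_conj.
have -> : w * z * w^-1 = z ^ w^-1 by rewrite conjgE invgK mulgA.
rewrite [LHS]ffunE [RHS]ffunE [RHS](reindex_inj (conjg_inj w^-1)).
by apply: eq_bigr => v _; rewrite -conjVg -conjMg !KnJ.
Qed.

End ConjugacyInWreath.

Local Open Scope ring_scope.

Lemma FHmul_basis (gT : finGroupType) (l m : ptype gT) :
  FHmul (FHK l) (FHK m) = FHmulK l m.
Proof.
by rewrite /FHmul /FHK !msuppU !oner_eq0 !big_seq_fset1 !mcoeffUU mulr1 scale1r.
Qed.

Lemma FHmulK_coef (gT : finGroupType) (l m u : ptype gT) : (FHmulK l m)@_u =
  if tnorm u == (tnorm l + tnorm m)%N then FHcoef l m u else 0.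
Proof.
rewrite /FHmulK /FHK -mem_ptypes_of_norm.
have: uniq (ptypes_of_norm gT (tnorm l + tnorm m)) by apply: undup_uniq.
move: (ptypes_of_norm _ _) (FHcoef l m) => s a s_uniq; rewrite raddf_sum /=.
case: ifP => [u_in|/negP u_in].
  rewrite (bigD1_seq u) //= mcoeffZ.
  rewrite mcoeffUU.
  rewrite mulr1.
  by rewrite big1 ?addr0 // => v nvu; rewrite mcoeffZ mcoeffU (negPf nvu) mulr0.
rewrite big_seq big1 // => v v_in; rewrite mcoeffZ mcoeffU.
by case: eqP v_in => [->|_]; rewrite ?mulr0.
Qed.

(* Main.v *)
Require Import Defs.
From mathcomp Require Import all_boot all_order all_fingroup all_algebra.
From mathcomp Require Import zify.

Set Implicit Arguments.
Unset Strict Implicit.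
Unset Printing Implicit Defensive.

Import GRing.Theory.

(** The coefficient of [K_u] in the product is the number of factorizations
    [z = x * y] of a fixed element [z] of modified type [u], where [x] has
    modified type [l] and [y] has modified type [(r)_c], i.e., [y] is a single
    [r]-cycle of class [c].

    The norm of a modified type is the number of points minus the number of
    cycles of trivial product.  So, when norms add up, [x] has [r] more cycles
    of trivial product than [z]; as those avoiding the support [S] of [y] are
    also cycles of [z], this is possible only if the [r] points of [S] lie on
    [r] distinct cycles of [x] with trivial product ([norm_gluable]).  The
    product then glues these cycles into one cycle, whose class is that of [y]
    and whose size is the sum of their sizes ([glue_wtype]).  If the sizes are
    the parts of [mu] increased by one and some ones, then [mu] is contained in
    [l] at the trivial class, has at most [r] parts, and the type of [z] is that
    of [x] with [mu] removed and the part [psize mu + r] added at [c]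
    ([product_rowtype]).

    Conversely, fix such a [mu] and an element [z] of the corresponding type,
    which exists by [exists_mtype].  In a gluing, [y] is the first-return map of
    [z] on [S], labels included ([glue_return]), so that [y] is determined by
    [z] and [S] ([gaps_inj]), and every nonempty subset [S] of a cycle of [z]
    arises ([cut_cycle]).  Hence a factorization with a marked point of [S] is
    the same as a point of [z] on a cycle of size [psize mu + r] and class [c],
    of which there are
    [(psize mu + r) * (pmult (psize mu + r) (l c) + 1)], together with an
    ordering of the [r] gaps, of which there are
    [r! / ((r - plen mu)! prod_i m_i(mu)!)].  Dividing by the [r] choices of the
    marked point gives the coefficient ([card_factorsE]). *)

(** * Rearrangements of sequences *)

(** The multinomial count of the rearrangements of a sequence, written without
    division. *)
Lemma size_permutations_count (s : seq nat) N : all (fun a => a < N) s ->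
  size (permutations s) * \prod_(0 <= i < N) (count_mem i s)`! = (size s)`!.
Proof.
move Dn: (size s) => n; elim: n s Dn => [|n IHn] s Dn sN.
  by case: s Dn sN => // _ _; rewrite big1 // => i _; rewrite fact0.
rewrite (perm_size (permutationsE _)) ?Dn // size_allpairs_dep sumnE big_map.
rewrite big_distrl /= factS -Dn.
have -> : size s = \sum_(a <- undup s) count_mem a s.
  rewrite -sum1_size -big_undup_iterop_count; apply: eq_bigr => a _.
  by rewrite Monoid.iteropE iter_addn_0 mul1n.
rewrite big_distrl /= [LHS]big_seq [RHS]big_seq; apply: eq_bigr => a.
rewrite mem_undup => sa.
have aN : a \in index_iota 0 N by rewrite mem_index_iota (allP sN).
rewrite -(IHn (rem a s)); first last.
- by apply/allP => b /mem_rem; apply: (allP sN).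
- by rewrite size_rem ?Dn.
rewrite mulnCA; congr muln.
rewrite !(bigD1_seq a aN) ?iota_uniq //= mulnA; congr muln; last first.
  apply: eq_bigr => b nb; rewrite count_mem_rem.
  by rewrite eq_sym (negPf nb) subn0.
rewrite count_mem_rem eqxx subn1.
have : 0 < count_mem a s by rewrite -has_count has_pred1.
by case: (count_mem a s).
Qed.

(** For sequences of equal size, the multiplicity of one value is determined by
    the multiplicities of all the others. *)
Lemma perm_eq_but1 (s t : seq nat) k : size s = size t ->
  (forall i, i != k -> count_mem i s = count_mem i t) -> perm_eq s t.
Proof.
move=> eq_sz eq_c; rewrite -(perm_filterC (pred1 k) s) perm_sym.
rewrite -(perm_filterC (pred1 k) t) perm_sym.
have eqF : perm_eq (filter (predC (pred1 k)) s) (filter (predC (pred1 k)) t).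
  apply/allP => i _ /=; rewrite !count_filter.
  have [->|ni] := eqVneq i k.
    by rewrite !(@eq_count _ _ pred0) ?count_pred0 // => j /=; case: eqP.
  have eqi : predI (pred1 i) (predC (pred1 k)) =1 pred1 i.
    by move=> j /=; case: (eqVneq j i) => // ->; rewrite ni.
  by rewrite !(eq_count eqi) eq_c.
apply: perm_cat => //.
have defF (u : seq nat) : filter (pred1 k) u = nseq (count_mem k u) k.
  by rewrite -size_filter; apply/all_pred1P/filter_all.
have : size (filter (predC (pred1 k)) s) = size (filter (predC (pred1 k)) t).
  exact: perm_size.
rewrite !size_filter => eqC.
rewrite !defF; suff -> : count_mem k s = count_mem k t by [].
apply: (@addIn (count (predC (pred1 k)) s)).
by rewrite count_predC eqC count_predC.
Qed.

(** * The action of a wreath product on labelled points *)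

Section WreathAction.

Variables (gT : finGroupType) (n : nat).
Implicit Types (x y z w : wreath gT n) (c : conjcl gT) (i j : 'I_n).
Implicit Types (a b : gT) (p : gT * 'I_n).

Local Open Scope group_scope.

(** The action of [x] on pairs (label, point) by left multiplication of the
    labels: [(a, i)] goes to [(g a, j)], where [j] is the image of [i] and [g]
    is the entry of [x] at [j].  It is faithful, it commutes with right
    multiplication of the labels, and the product of the cycle through [i] can
    be read off when the point [i] is first reached again. *)
Definition wtr x p : gT * 'I_n :=
  (wbase x (wperm x p.2) * p.1, wperm x p.2).

Lemma wtrM x y p : wtr (x * y) p = wtr x (wtr y p).
Proof.
by case: p => a i; rewrite /wtr wpermM wbaseM /= permK mulgA.
Qed.

Lemma wtr1 p : wtr 1 p = p.
Proof. by case: p => a i; rewrite /wtr /= ffunE perm1 mul1g. Qed.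

Lemma wtrX x m p : wtr (x ^+ m) p = iter m (wtr x) p.
Proof. by elim: m => [|m IHm]; rewrite ?expg0 ?wtr1 // expgS wtrM IHm. Qed.

Lemma wtr_fstM x a b i : wtr x (a * b, i) = ((wtr x (a, i)).1 * b, wperm x i).
Proof. by rewrite /wtr /= mulgA. Qed.

Lemma wtr_eq1 x y i : wtr x (1, i) = wtr y (1, i) ->
  forall a, wtr x (a, i) = wtr y (a, i).
Proof. by move=> [+ e] a; rewrite /wtr /= !mulg1 e => ->. Qed.

Lemma wtr_inj x y : (forall i, wtr x (1, i) = wtr y (1, i)) -> x = y.
Proof.
move=> exy; apply: eq_wreath => i; last by case: (exy i).
have := exy ((wperm x)^-1 i); rewrite /wtr /= !mulg1.
by case=> + e; rewrite -e permKV.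
Qed.

Lemma iter_wtr x m a i :
  iter m (wtr x) (a, i) = (cpart x (wperm x i) m * a, iter m (wperm x) i).
Proof.
elim: m => [|m IHm]; first by rewrite cpart0 mul1g.
by rewrite iterS IHm cpartSr /wtr /= mulgA -iterSr.
Qed.

Lemma iter_wtr_snd x m p : (iter m (wtr x) p).2 = iter m (wperm x) p.2.
Proof. by case: p => a i; rewrite iter_wtr. Qed.

Lemma iter_perm_orbit (s : 'S_n) m i : iter m s i \in porbit s i.
Proof. by rewrite -permX mem_porbit. Qed.

(** The size and the class of the cycle of [x] through [i]. *)
Definition ckey x i : nat * conjcl gT :=
  (#|porbit (wperm x) i|, clof (cycprod x i)).

Lemma porbit_gt0 (s : 'S_n) i : 0 < #|porbit s i|.
Proof. by rewrite lt0n card_porbit_neq0. Qed.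

Lemma ckey_porbit x i j : j \in porbit (wperm x) i -> ckey x j = ckey x i.
Proof.
move=> ji; rewrite /ckey (cycprod_porbit ji).
suff /eqP-> : porbit (wperm x) j == porbit (wperm x) i by [].
by rewrite eq_porbit_mem.
Qed.

(** The cycle-product through [i], up to conjugacy, is the label with which
    [(1, i)] comes back to [i]. *)
Lemma clof_cycprod x i :
  clof (cycprod x i) = clof (iter #|porbit (wperm x) i| (wtr x) (1, i)).1.
Proof.
rewrite iter_wtr mulg1 -cycprod_step /cycprod /cpart.
by rewrite porbit_step.
Qed.

Lemma porbit_in_iter (s : 'S_n) i j : j \in porbit s i ->
  exists2 m, m < #|porbit s i| & j = iter m s i.
Proof. by rewrite porbit_traject => /trajectP. Qed.

Lemma porbit_in_iter1 (s : 'S_n) i j : j \in porbit s i ->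
  exists2 m, 0 < m <= #|porbit s i| & j = iter m s i.
Proof.
move=> /porbit_in_iter[[|m] lt_m ->].
  by exists #|porbit s i|; rewrite ?porbit_gt0 ?leqnn ?iter_porbit.
by exists m.+1; rewrite // (ltnW lt_m).
Qed.

Lemma iter_neq (s : 'S_n) i m : 0 < m < #|porbit s i| -> iter m s i != i.
Proof.
case/andP=> m0 mlt; apply/eqP => e.
have := @eq_iter_porbit _ s i m 0 mlt (porbit_gt0 _ _) e.
by move=> em; rewrite em in m0.
Qed.

Lemma card_porbit_first (s : 'S_n) i k : 0 < k -> iter k s i = i ->
  (forall m, 0 < m < k -> iter m s i != i) -> #|porbit s i| = k.
Proof.
move=> k0 ek lt; apply/eqP; rewrite eqn_leq; apply/andP; split.
  rewrite leqNgt; apply/negP=> ltk.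
  by have := @iter_neq s i k; rewrite k0 ltk ek eqxx => /(_ isT).
rewrite leqNgt; apply/negP=> ltk.
have := lt #|porbit s i|; rewrite porbit_gt0 ltk iter_porbit eqxx.
by move=> /(_ isT).
Qed.

Lemma clof1 a : (clof a == conjcl1 gT) = (a == 1).
Proof. by rewrite -clofP /= inE. Qed.

Lemma iter_wtr_triv x i : clof (cycprod x i) = conjcl1 gT ->
  forall a, iter #|porbit (wperm x) i| (wtr x) (a, i) = (a, i).
Proof.
rewrite clof_cycprod => /eqP; rewrite clof1 !iter_wtr /= mulg1 => /eqP e a.
by rewrite iter_wtr e mul1g iter_porbit.
Qed.

(** The points lying on cycles of size [k] and class [c].  Counting these
    points amounts to counting the cycles, each of which has [k] points. *)
Definition kpts x k c := [set i | ckey x i == (k, c)].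

Lemma card_kpts x k c : 0 < k -> #|kpts x k c| = (k * pmult k (wtype x c))%N.
Proof.
move=> k0; rewrite pmult_wtype // -sum1_card.
rewrite (partition_big_imset (porbit (wperm x))) /=.
rewrite (eq_bigr (fun _ => k)) => [|_ /imsetP[i + ->]]; last first.
  rewrite inE => /eqP ki; rewrite sum1dep_card -[RHS]/(k, c).1 -ki.
  apply: eq_card => j; rewrite !inE eq_porbit_mem andbC.
  by case: (boolP (j \in _)) => //= /ckey_porbit->; rewrite ki eqxx.
rewrite sum_nat_const mulnC; congr muln; apply: eq_card => C.
rewrite inE; apply/imsetP/andP => [[i + ->]|[/cycles_inP[i -> ci] szC]].
  by rewrite inE xpair_eqE mem_cycles_in => /andP[].
by exists i; rewrite // inE xpair_eqE szC ci eqxx.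
Qed.

(** An element that acts as [x] on a whole cycle of [x] has this cycle too,
    with the same product. *)
Lemma ckey_agree x z i :
  (forall j, j \in porbit (wperm x) i -> wtr z (1, j) = wtr x (1, j)) ->
  porbit (wperm z) i = porbit (wperm x) i /\ ckey z i = ckey x i.
Proof.
move=> zx; have it m : iter m (wtr z) (1, i) = iter m (wtr x) (1, i).
  elim: m => // m IHm; rewrite !iterS IHm iter_wtr.
  by apply/wtr_eq1/zx; rewrite iter_perm_orbit.
have pi m : iter m (wperm z) i = iter m (wperm x) i.
  by have := congr1 snd (it m); rewrite !iter_wtr_snd.
have eqp : porbit (wperm z) i = porbit (wperm x) i.
  apply/setP => j; apply/porbitP/porbitP => -[m ->]; exists m;
    by rewrite !permX pi.
by split=> //; rewrite /ckey !clof_cycprod eqp it.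
Qed.

End WreathAction.

(** * Gluing cycles of trivial product *)

Section Gluing.

Variables (gT : finGroupType) (n : nat).
Implicit Types (c : conjcl gT) (i j w : 'I_n) (a : gT).

Local Open Scope group_scope.

(** [y] fixes every point outside [S], and the labels there. *)
Definition supported_on (y : wreath gT n) (S : {set 'I_n}) :=
  forall i, i \notin S -> wtr y (1, i) = (1, i).

(** The cycles of [x] through the points of [S] have trivial product and meet
    [S] in a single point each. *)
Definition gluable (x : wreath gT n) (S : {set 'I_n}) :=
  forall i, i \in S -> clof (cycprod x i) = conjcl1 gT
    /\ forall j, j \in S -> j \in porbit (wperm x) i -> j = i.

(** The sizes of the cycles of [x] met along the cycle of [y] through [s].  The
    list starts at the image of [s] by [y] rather than at [s]: when the cycles
    can be glued, its term of index [m] is the time that [x * y] takes to go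
    from the [m]-th to the [m.+1]-th point of the cycle of [y]. *)
Definition gaps (x y : wreath gT n) (s : 'I_n) : seq nat :=
  [seq #|porbit (wperm x) i|
    | i <- traject (wperm y) (wperm y s) #|porbit (wperm y) s|].

Lemma size_gaps x y s : size (gaps x y s) = #|porbit (wperm y) s|.
Proof. by rewrite size_map size_traject. Qed.

Lemma nth_gaps x y s m : m < #|porbit (wperm y) s| ->
  nth 0%N (gaps x y s) m = #|porbit (wperm x) (iter m.+1 (wperm y) s)|.
Proof.
move=> lt_m; rewrite (nth_map (wperm y s)) ?size_traject //.
by rewrite (nth_traject (wperm y) lt_m) -iterSr.
Qed.

Lemma gaps_gt0 x y s : all (leq 1) (gaps x y s).
Proof. by apply/allP => _ /mapP[i _ ->]; exact: porbit_gt0. Qed.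

Lemma gaps_perm x y s : perm_eq (gaps x y s)
  [seq #|porbit (wperm x) i| | i <- enum (porbit (wperm y) s)].
Proof.
apply/perm_map/uniq_perm; rewrite ?enum_uniq //.
  by rewrite -porbit_step uniq_traject_porbit.
by move=> i; rewrite mem_enum -porbit_step -porbit_traject porbit_step.
Qed.

Lemma sumn_gaps x y s :
  sumn (gaps x y s) = \sum_(i in porbit (wperm y) s) #|porbit (wperm x) i|.
Proof. by rewrite (perm_sumn (gaps_perm _ _ _)) sumnE big_map big_enum. Qed.

Lemma count_gaps x y s k : count_mem k (gaps x y s)
  = #|[set i in porbit (wperm y) s | #|porbit (wperm x) i| == k]|.
Proof.
rewrite (seq.permP (gaps_perm _ _ _)) count_map -size_filter cardE /enum_mem.
rewrite -filter_predI; congr size; apply: eq_filter => i.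
by rewrite !inE andbC.
Qed.

(* From here on, y is a single cycle S, whose points lie on distinct cycles of
   x with trivial product; U is the union of these cycles of x. *)
Variables (x y : wreath gT n) (s : 'I_n).
Let S := porbit (wperm y) s.
Let U := \bigcup_(i in S) porbit (wperm x) i.
Let z := x * y.
Let L := sumn (gaps x y s).

Hypothesis supp_y : supported_on y S.
Hypothesis glue_x : gluable x S.

Lemma wtr_supported i a : i \notin S -> wtr y (a, i) = (a, i).
Proof.
move=> iS; rewrite -[RHS]wtr1; apply: wtr_eq1.
by rewrite wtr1 supp_y.
Qed.

Lemma wperm_supported i : i \notin S -> wperm y i = i.
Proof. by move=> iS; have [] := supp_y iS. Qed.

Lemma glue_step i : i \in S -> wperm y i \in S.
Proof. by rewrite -!eq_porbit_mem porbit_step. Qed.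

(** After [y] has moved a point of [S], the product [x * y] follows [x] until
    it is back in [S]. *)
Lemma glue_iter i m a : i \in S -> 0 < m <= #|porbit (wperm x) (wperm y i)| ->
  iter m (wtr z) (a, i) = iter m (wtr x) (wtr y (a, i)).
Proof.
move=> iS; elim: m => [//|[|m] IHm] /andP[_ lem].
  by rewrite /= /z wtrM.
rewrite iterS IHm ?(ltnW lem) // /z wtrM [RHS]iterS; congr wtr.
have yiS := glue_step iS.
rewrite [wtr y (a, i)]/wtr /= -iterS iter_wtr wtr_supported //.
apply: contraTN isT => jS.
have := (glue_x yiS).2 _ jS (iter_perm_orbit _ _ _) => /eqP.
by rewrite (negPf (iter_neq _)) // lem.
Qed.

(** The first return to [S] of the action of [x * y] is [y], labels included,
    since the cycles of [x] have trivial product. *)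
Lemma glue_return i a : i \in S ->
  iter #|porbit (wperm x) (wperm y i)| (wtr z) (a, i) = wtr y (a, i).
Proof.
move=> iS; rewrite glue_iter ?porbit_gt0 ?leqnn //.
rewrite [wtr y _]/wtr /= iter_wtr_triv //.
by have [] := glue_x (glue_step iS).
Qed.

(** Starting from [s], the [m]-th return of [x * y] to [S] acts as the power
    [y ^+ m]. *)
Lemma glue_winding m a : m <= #|S| ->
  iter (sumn (take m (gaps x y s))) (wtr z) (a, s) = iter m (wtr y) (a, s).
Proof.
elim: m => [|m IHm] le_m; first by rewrite take0.
rewrite (take_nth 0%N) ?size_gaps // sumn_rcons addnC iterD IHm ?(ltnW le_m) //.
rewrite nth_gaps // [RHS]iterS iter_wtr glue_return //; exact: iter_perm_orbit.
Qed.

Lemma glue_unionP w :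
  reflect (exists2 i, i \in S & w \in porbit (wperm x) i) (w \in U).
Proof. exact: (iffP bigcupP). Qed.

(** The product has a single cycle in place of the cycles of [x] that meet
    [S]. *)
Lemma glue_porbit : porbit (wperm z) s = U.
Proof.
have sS : s \in S by rewrite porbit_id.
apply/setP => w; apply/idP/glue_unionP => [|[i iS /porbit_in_iter1[m m_gt0]]].
  case/porbitP => m ->; rewrite permX; elim: m => [|m [i iS wi]].
    by exists s; rewrite // porbit_id.
  rewrite iterS; move: (iter m (wperm z) s) wi => w' wi; rewrite /z wpermM.
  have st j k : j \in porbit (wperm x) k -> wperm x j \in porbit (wperm x) k.
    by rewrite -!eq_porbit_mem porbit_step.
  have [wS|wS] := boolP (w' \in S).
    by exists (wperm y w'); rewrite ?glue_step ?st ?porbit_id.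
  by exists i; rewrite // wperm_supported ?st.
have S_z j : j \in S -> j \in porbit (wperm z) s.
  case/porbitP => k ->; rewrite permX.
  elim: k => [|k IHk]; first by rewrite porbit_id.
  rewrite iterS; move: (iter_perm_orbit (wperm y) k s) IHk.
  move: (iter k (wperm y) s) => v vS vz.
  have := congr1 snd (glue_return 1 vS); rewrite iter_wtr_snd /= => <-.
  move: vz; rewrite -!eq_porbit_mem => /eqP <-.
  by rewrite eq_porbit_mem iter_perm_orbit.
have [i' i'S def_i] : exists2 i', i' \in S & i = wperm y i'.
  exists ((wperm y)^-1 i); last by rewrite permKV.
  rewrite -!eq_porbit_mem -(porbit_step _ ((wperm y)^-1 i)) permKV.
  by rewrite eq_porbit_mem.
rewrite def_i in m_gt0 * => ->.
have := congr1 snd (glue_iter 1 i'S m_gt0); rewrite !iter_wtr_snd /= => <-.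
have := S_z _ i'S; rewrite -!eq_porbit_mem => /eqP <-.
by rewrite eq_porbit_mem iter_perm_orbit.
Qed.

(** The cycles of [x] that meet [S] are disjoint. *)
Lemma glue_sum (F : 'I_n -> nat) :
  \sum_(w in U) F w = \sum_(i in S) \sum_(w in porbit (wperm x) i) F w.
Proof.
rewrite (exchange_big_dep (mem U)) /=; last first.
  by move=> i w iS wi; apply/glue_unionP; exists i.
apply: eq_bigr => w /glue_unionP[i iS wi].
rewrite (big_pred1 i) // => j /=; apply/andP/eqP => [[jS wj]|-> //].
have [_ /(_ _ jS)] := glue_x iS; apply.
by move: wi wj; rewrite -!eq_porbit_mem => /eqP-> /eqP->.
Qed.

Lemma glue_card : #|U| = L.
Proof.
rewrite -sum1_card glue_sum /L sumn_gaps; apply: eq_bigr => i _.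
by rewrite sum1_card.
Qed.

(** One turn around the glued cycle of [x * y] has the same effect on labels as
    one turn around the cycle of [y]. *)
Lemma glue_class : clof (cycprod z s) = clof (cycprod y s).
Proof.
rewrite !clof_cycprod glue_porbit glue_card /L -(glue_winding _ (leqnn _)).
by rewrite /S -(size_gaps x) take_size.
Qed.

Lemma glue_ckey_in w : w \in U -> ckey z w = (L, clof (cycprod y s)).
Proof.
rewrite -glue_porbit => /ckey_porbit->.
by rewrite /ckey glue_class glue_porbit glue_card.
Qed.

Lemma glue_ckey_notin w : w \notin U -> ckey z w = ckey x w.
Proof.
move=> wU; have [] // := @ckey_agree _ _ x z w.
move=> j jw; rewrite /z wtrM supp_y //; apply: contra wU => jS.
by apply/glue_unionP; exists j; rewrite // porbit_sym.
Qed.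

(** How gluing changes the type: the cycles of [x] through [S], whose sizes are
    the gaps, are removed from the trivial class, and one cycle is added, whose
    size is the sum of the gaps and whose class is that of [y]. *)
Lemma glue_wtype k c : 0 < k ->
  (pmult k (wtype z c)
     + (c == conjcl1 gT) * count_mem k (gaps x y s)
   = pmult k (wtype x c) + ((k, c) == (L, clof (cycprod y s))))%N.
Proof.
move=> k0; apply/eqP; rewrite -(eqn_pmul2l k0) !mulnDr -!card_kpts //.
(* Compare the points on cycles of size k and class c in x and x * y, inside
   and outside U. *)
have split_U (v : wreath gT n) : #|kpts v k c|
  = (\sum_(w in U) (ckey v w == (k, c)) + #|kpts v k c :\: U|)%N.
  rewrite -(cardsID U) -sum1_card big_mkcond [X in _ = (X + _)%N]big_mkcond /=.
  congr (_ + _)%N; apply: eq_bigr => w _.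
  by rewrite !inE; case: (_ == _); case: (w \in U).
have eqD : #|kpts z k c :\: U| = #|kpts x k c :\: U|.
  apply: eq_card => w; rewrite !inE; case: (boolP (w \in U)) => //= wU.
  by rewrite glue_ckey_notin.
rewrite !split_U eqD.
rewrite (eq_bigr (fun=> nat_of_bool ((L, clof (cycprod y s)) == (k, c))));
  last by move=> w /glue_ckey_in->.
rewrite sum_nat_const glue_card glue_sum.
apply/eqP; rewrite [(L, _) == _]eq_sym.
have -> : (\sum_(i in S) \sum_(w in porbit (wperm x) i) (ckey x w == (k, c))
  = k * ((c == conjcl1 gT) * count_mem k (gaps x y s)))%N.
  rewrite count_gaps -sum1dep_card big_mkcondr !big_distrr /=.
  apply: eq_bigr => i iS.
  rewrite (eq_bigr (fun _ => nat_of_bool (ckey x i == (k, c)))); last first.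
    by move=> w /ckey_porbit->.
  rewrite sum_nat_const /ckey (glue_x iS).1 xpair_eqE [c == _]eq_sym.
  by case: eqP => [->|_]; case: (_ == c); rewrite ?muln0.
have -> : (L * ((k, c) == (L, clof (cycprod y s)))
  = k * ((k, c) == (L, clof (cycprod y s))))%N.
  by rewrite xpair_eqE; case: eqP => [->|] //=; rewrite !muln0.
by rewrite addnC [RHS]addnAC addnA.
Qed.

End Gluing.

(** * Elements whose modified type is a single row *)

Section ModifiedTypes.

Variables (gT : finGroupType) (n : nat).
Implicit Types (x y z : wreath gT n) (c d : conjcl gT) (i j s : 'I_n).
Implicit Types (u : ptype gT).

Local Notation c0 := (conjcl1 gT).

Lemma pmult_mtype1 x k :
  pmult k.+1 (mtype x c0) = pmult k.+2 (wtype x c0).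
Proof.
by rewrite /mtype ffunE eqxx pmult_mkpart // count_map; apply: eq_count; case.
Qed.

Lemma mtype_neq1 x c : c != c0 -> mtype x c = wtype x c.
Proof. by rewrite [mtype x c]ffunE => /negPf->. Qed.

Lemma mtype_eqP x u :
    (forall k c, 0 < k -> c != c0 -> pmult k (wtype x c) = pmult k (u c)) ->
    (forall k, pmult k.+2 (wtype x c0) = pmult k.+1 (u c0)) ->
  mtype x = u.
Proof.
move=> eq_c eq_1; apply/ffunP => c; apply: eq_intpart => -[//|k] _.
have [->|nc] := eqVneq c c0; first by rewrite pmult_mtype1 eq_1.
by rewrite mtype_neq1 // eq_c.
Qed.

Lemma pmult_trow k r c d : 0 < k ->
  pmult k (trow r c d) = ((k, d) == (r, c)).
Proof.
move=> k0; rewrite /trow /tsupp ffunE xpair_eqE andbC.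
case: eqP => _; last by rewrite pmult_mkpart.
by rewrite pmult_mkpart //= addn0 eq_sym.
Qed.

Lemma psize_pred (p : intpart) :
  psize (mkpart [seq k.-1 | k <- p]) + plen p = psize p.
Proof.
rewrite psize_mkpart /psize /plen; have /andP[_] := partsP p.
elim: (parts p) => //= k t IHt; rewrite inE negb_or => /andP[k0 /IHt].
by move: k0; lia.
Qed.

Lemma plen_wtype x c : plen (wtype x c) = #|cycles_in x c|.
Proof.
rewrite /wtype ffunE /plen /= size_sort size_filter.
rewrite (_ : count _ _ = size [seq #|C| | C : {set 'I_n} in cycles_in x c]).
  by rewrite size_image.
apply/eqP; rewrite -all_count; apply/allP => _ /imageP[C Cx ->].
case/cycles_inP: Cx => i -> _; exact: porbit_gt0.
Qed.

(** The norm of the modified type is the number of points minus the number of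
    cycles of trivial product. *)
Lemma tnorm_mtype x : tnorm (mtype x) + #|cycles_in x c0| = n.
Proof.
have tnormD u : tnorm u = psize (u c0) + \sum_(c | c != c0) psize (u c).
  by rewrite /tnorm (bigD1 c0).
have m1 : mtype x c0 = mkpart [seq k.-1 | k <- wtype x c0].
  by rewrite [LHS]ffunE eqxx.
rewrite -[RHS](tnorm_wtype x) -plen_wtype !tnormD -(psize_pred (wtype x c0)).
rewrite -m1 addnAC; congr addn.
by apply: eq_bigr => c nc; rewrite mtype_neq1.
Qed.

End ModifiedTypes.

Section CycleElements.

Variables (gT : finGroupType) (n : nat).
Implicit Types (x y z : wreath gT n) (c d : conjcl gT) (i j s : 'I_n).

Local Notation c0 := (conjcl1 gT).
Local Open Scope group_scope.

Lemma card_kpts_row r c y : 0 < r -> c != c0 -> mtype y = trow r c ->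
  #|kpts y r c| = r.
Proof.
move=> r0 nc my; rewrite card_kpts // -mtype_neq1 // my pmult_trow //.
by rewrite eqxx muln1.
Qed.

Lemma supported_row r c y : 0 < r -> c != c0 -> mtype y = trow r c ->
  supported_on y (kpts y r c).
Proof.
move=> r0 nc my i; rewrite inE => ni.
have Ei := porbit_gt0 (wperm y) i.
have key_pos : 0 < pmult #|porbit (wperm y) i| (wtype y (clof (cycprod y i))).
  rewrite -(ltn_pmul2l Ei) muln0 -card_kpts //.
  by apply/card_gt0P; exists i; rewrite inE.
have [eq1|neq1] := eqVneq (clof (cycprod y i)) c0; last first.
  move: key_pos; rewrite -mtype_neq1 // my pmult_trow // -/(ckey y i).
  by rewrite (negPf ni).
have := @iter_wtr_triv _ _ y i eq1 1; move: key_pos Ei; rewrite eq1.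
case: #|_| => [|[|k]] //.
rewrite -pmult_mtype1 my pmult_trow // xpair_eqE [c0 == c]eq_sym.
by rewrite (negPf nc) andbF.
Qed.

(** An element of modified type [(r)_c], with [c] nontrivial, is a single
    [r]-cycle: its support is this cycle. *)
Lemma porbit_row r c y s : 0 < r -> c != c0 -> mtype y = trow r c ->
  s \in kpts y r c -> porbit (wperm y) s = kpts y r c.
Proof.
move=> r0 nc my sT; apply/eqP; rewrite eqEcard card_kpts_row //.
have /eqP[-> _] : ckey y s == (r, c) by rewrite inE in sT.
rewrite leqnn andbT; apply/subsetP => i /ckey_porbit.
by move: sT; rewrite !inE => /eqP-> ->.
Qed.

Lemma ckey1 i : ckey (1 : wreath gT n) i = (1%N, c0).
Proof.
have e1 : #|porbit (wperm (1 : wreath gT n)) i| = 1%N.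
  by apply: card_porbit_first => //=; [rewrite perm1 | case=> [|[]]].
rewrite /ckey clof_cycprod e1; congr pair; apply/eqP.
by rewrite clof1; apply/eqP; exact: (congr1 fst (wtr1 (1, i))).
Qed.

Lemma wtype1 k c : 0 < k ->
  pmult k (wtype (1 : wreath gT n) c) = (((k, c) == (1%N, c0)) * n)%N.
Proof.
move=> k0; apply/eqP; rewrite -(eqn_pmul2l k0) -card_kpts //.
have -> : #|kpts (1 : wreath gT n) k c| = (((k, c) == (1%N, c0)) * n)%N.
  rewrite /kpts; case: eqP => [->|nk].
    rewrite mul1n -[RHS]card_ord; apply: eq_card => i.
    by rewrite !inE ckey1 eqxx.
  by apply: eq_card0 => i; rewrite !inE ckey1; apply/eqP => e; case: nk.
apply/eqP; rewrite xpair_eqE.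
by case: eqP => [->|_]; rewrite ?mul1n ?mul0n ?muln0.
Qed.

Lemma gluable_fixed x (S : {set 'I_n}) :
  (forall i, i \in S -> ckey x i = (1%N, c0)) -> gluable x S.
Proof.
move=> key_x i /key_x ki; split=> [|j _ ji]; first exact: (congr1 snd ki).
have /eq_leq/card_le1_eqP := congr1 fst ki.
by apply=> //; exact: porbit_id.
Qed.

Lemma gaps_fixed x y s :
    (forall i, i \in porbit (wperm y) s -> ckey x i = (1%N, c0)) ->
  gaps x y s = nseq #|porbit (wperm y) s| 1%N.
Proof.
move=> key_x; rewrite -(size_gaps x).
apply/all_pred1P/allP => _ /mapP[i + ->].
rewrite -porbit_step -porbit_traject porbit_step => /key_x ki.
exact/eqP/(congr1 fst ki).
Qed.

(** Conversely, a single [r]-cycle of class [c] has modified type [(r)_c].  It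
    is obtained by gluing [r] of the fixed points of the identity. *)
Lemma row_mtype r c y s : 0 < r -> c != c0 ->
    supported_on y (porbit (wperm y) s) -> ckey y s = (r, c) ->
  mtype y = trow r c.
Proof.
move=> r0 nc supp_y [sz cl].
have key1 i : i \in porbit (wperm y) s ->
  ckey (1 : wreath gT n) i = (1%N, c0) by move=> _; exact: ckey1.
have gw := glue_wtype supp_y (gluable_fixed key1).
rewrite mul1g cl (gaps_fixed key1) sumn_nseq mul1n sz in gw.
apply: mtype_eqP => [k d k0 nd|k].
  have := gw k d k0; rewrite (negPf nd) mul0n addn0 wtype1 // => ->.
  by rewrite xpair_eqE (negPf nd) andbF pmult_trow.
have := gw k.+2 c0 isT; rewrite wtype1 // pmult_trow // !xpair_eqE.
rewrite [c0 == c]eq_sym (negPf nc) !andbF /= => /eqP.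
by rewrite addn_eq0 => /andP[/eqP].
Qed.

(** Construction of a cycle along [ps] with prescribed labels [e i] on the steps
    leaving the points [i] of [ps]. *)
Lemma exists_cycle (ps : seq 'I_n) (e : 'I_n -> gT) : uniq ps ->
  exists y, [/\ supported_on y [set i in ps],
    forall i, i \in ps -> wtr y (1, i) = (e i, next ps i)
    & forall s, s \in ps -> porbit (wperm y) s = [set i in ps]].
Proof.
move=> Ups; pose p := perm (can_inj (prev_next Ups)).
pose y : wreath gT n :=
  Wreath [ffun i => if i \in ps then e (prev ps i) else 1] p.
have next_out i : i \notin ps -> next ps i = i.
  by move=> ni; rewrite next_nth (negPf ni).
exists y; split=> [i|i ips|s sps].
- rewrite inE => ni; rewrite /wtr /= ffunE permE next_out // (negPf ni).
  by rewrite mul1g.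
- by rewrite /wtr /= ffunE permE mem_next ips prev_next // mulg1.
apply/setP => i; rewrite inE -(fconnect_cycle (cycle_next Ups) sps).
apply/porbitP/idP => [[m ->]|/iter_findex <-].
  rewrite permX (eq_iter (f' := next ps)) ?fconnect_iter // => j.
  by rewrite permE.
exists (findex (next ps) s i); rewrite permX.
by apply: eq_iter => j; rewrite permE.
Qed.

(** Additivity of norms forces gluing.  The cycles of trivial product of [x]
    that avoid the support of [y] are cycles of [x * y], and at most [r] of them
    meet this support; [x] having [r] more such cycles than [x * y], exactly
    [r] of them do, so the points of the support lie on distinct cycles of
    trivial product. *)
Lemma norm_gluable r c x y : 0 < r -> c != c0 -> mtype y = trow r c ->
    tnorm (mtype (x * y)) = (tnorm (mtype x) + r)%N ->
  gluable x (kpts y r c).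
Proof.
move=> r0 nc my norm_xy; set T := kpts y r c.
have szT : #|T| = r by rewrite /T card_kpts_row.
have suppT : supported_on y T by exact: supported_row.
have eqA : #|cycles_in x c0| = (#|cycles_in (x * y)%g c0| + r)%N.
  apply: (@addnI (tnorm (mtype x))).
  by rewrite tnorm_mtype addnCA -norm_xy addnC tnorm_mtype.
pose T' := [set i in T | clof (cycprod x i) == c0].
have subA : cycles_in x c0 \subset
    cycles_in (x * y) c0 :|: porbit (wperm x) @: T'.
  apply/subsetP => C /cycles_inP[i -> cl_i]; rewrite inE.
  have [|no] := boolP [exists j in T, j \in porbit (wperm x) i].
    case/exists_inP => j jT ji; apply/orP; right; apply/imsetP; exists j.
      by rewrite inE jT (cycprod_porbit ji) cl_i eqxx.
    by apply/esym/eqP; rewrite eq_porbit_mem.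
  have [|eqp /(congr1 snd)/= eqc] := @ckey_agree _ _ x (x * y) i.
    move=> j ji; rewrite wtrM suppT //; apply: contra no => jT.
    by apply/exists_inP; exists j.
  by rewrite -eqp mem_cycles_in eqc cl_i eqxx.
have cI : #|porbit (wperm x) @: T'| <= #|T'| := leq_imset_card _ _.
have sT : T' \subset T by apply/subsetP => i; rewrite inE => /andP[].
have cT : #|T'| <= #|T| := subset_leq_card sT.
have cU := leq_trans (subset_leq_card subA) (leq_card_setU _ _).1.
have cIr : r <= #|porbit (wperm x) @: T'|.
  by move: cU; rewrite eqA leq_add2l.
have eT : T' = T.
  by apply/eqP; rewrite eqEcard sT szT (leq_trans cIr).
have injT : {in T &, injective (porbit (wperm x))}.
  by apply/imset_injP; rewrite -eT eqn_leq cI eT szT -eT.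
move=> i iT; split.
  by apply/eqP; move: iT; rewrite -{1}eT inE => /andP[].
by move=> j jT ji; apply: injT => //; apply/eqP; rewrite eq_porbit_mem.
Qed.

End CycleElements.

(** * Elements of a given modified type *)

Section Existence.

Variables (gT : finGroupType).
Implicit Types (c d : conjcl gT) (u : ptype gT).

Local Notation c0 := (conjcl1 gT).

Lemma conjcl_clof c : exists a : gT, clof a = c.
Proof.
have /imsetP[a _ def_c] := valP c; exists a.
by apply/eqP; rewrite -clofP def_c class_refl.
Qed.

(** An element with a given list of cycles (size, class), all other points
    being fixed with trivial label: the cycles are added one at a time, by
    gluing fixed points. *)
Lemma exists_cycles n (ks : seq (nat * conjcl gT)) :
    all (fun kc => 0 < kc.1) ks -> sumn (unzip1 ks) <= n ->
  exists z : wreath gT n, forall k c, 0 < k ->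
    pmult k (wtype z c) = count_mem (k, c) ks
      + ((k, c) == (1, c0)) * (n - sumn (unzip1 ks)).
Proof.
elim: ks => [_ _|[k c] ks IHks /= /andP[k0 ks0] le_n].
  by exists 1%g => k c k0; rewrite wtype1 // subn0.
have le_kn := leq_trans (leq_addl _ _) le_n.
have [//|//|x typ_x] := IHks.
pose F := kpts x 1 c0.
have le_kF : k <= #|F|.
  rewrite card_kpts // mul1n typ_x // eqxx mul1n.
  by move: le_n; lia.
pose ps := take k (enum F).
have sz_ps : size ps = k by rewrite size_takel // -cardE.
have Ups : uniq ps by rewrite take_uniq ?enum_uniq.
have psF i : i \in ps -> ckey x i = (1, c0).
  by move/mem_take; rewrite mem_enum inE => /eqP.
have [s sps] : exists s : 'I_n, s \in ps.
  by case: (ps) sz_ps k0 => [<- //|s t _ _]; exists s; rewrite mem_head.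
have [a cl_a] := conjcl_clof c.
(* All labels of the new cycle are trivial, except on the step leaving s, so
   that its product is a. *)
have [y [supp_y wtr_y orb_y]] :=
  exists_cycle (fun i => if i == s then a else 1%g) Ups.
have orb_s := orb_y s sps.
rewrite -orb_s in supp_y.
have card_s : #|porbit (wperm y) s| = k.
  by rewrite orb_s cardsE (card_uniqP Ups).
have mem_ps i : (i \in porbit (wperm y) s) = (i \in ps).
  by rewrite orb_s inE.
have y_class : clof (cycprod y s) = c.
  rewrite -cl_a clof_cycprod card_s.
  have it m : 0 < m <= k -> (iter m (wtr y) (1%g, s)).1 = a.
    elim: m => [//|[|m] IHm] le_m.
      by rewrite iterS wtr_y //= eqxx.
    rewrite iterS; move: (IHm (ltnW le_m)); rewrite iter_wtr.
    set i := iter m.+1 (wperm y) s.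
    have ni : i != s by apply: iter_neq; rewrite card_s.
    have ips : i \in ps by rewrite -mem_ps iter_perm_orbit.
    move=> eq_a; rewrite [X in (X, i)]eq_a -[a in (a, i)]mul1g wtr_fstM.
    by rewrite wtr_y //= (negPf ni) mul1g.
  by rewrite it // k0 leqnn.
have key_x i : i \in porbit (wperm y) s -> ckey x i = (1, c0).
  by rewrite mem_ps; exact: psF.
exists (x * y)%g => j d j0.
have := glue_wtype supp_y (gluable_fixed key_x) d j0.
rewrite (gaps_fixed key_x) card_s sumn_nseq mul1n y_class count_nseq.
rewrite typ_x //= !xpair_eqE.
rewrite [j == k]eq_sym [d == c]eq_sym.
have [->|] := eqVneq j 1; have [->|] := eqVneq d c0 => /=; move: le_n; lia.
Qed.

(** The stable bound of [u] is the total size of the cycles that [u] describes,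
    so that no further fixed points are needed. *)
Lemma exists_mtype u : exists z : wreath gT (stable_bound u), mtype z = u.
Proof.
(* At the trivial class, a part k of the modified type is a cycle of size
   k + 1. *)
pose f c k := (k + (c == c0), c).
pose ks := flatten [seq [seq f c k | k <- u c] | c <- enum {: conjcl gT}].
have posu c k : k \in parts (u c) -> 0 < k.
  by have /andP[_] := partsP (u c); case: k => // /negPf->.
have ks0 : all (fun kc => 0 < kc.1) ks.
  apply/allP => _ /flatten_mapP[c _ /mapP[k /posu k0 ->]] /=.
  by rewrite addn_gt0 k0.
have sum_ks : sumn (unzip1 ks) = stable_bound u.
  rewrite /unzip1 map_flatten -map_comp sumn_flatten -map_comp.
  rewrite sumnE big_map big_enum /=.
  rewrite /stable_bound /tnorm.
  rewrite (eq_bigr (fun c => psize (u c) + (c == c0) * plen (u c))).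
    rewrite big_split /=; congr addn.
    rewrite (bigD1 c0) //= eqxx mul1n big1 ?addn0 // => c nc.
    by rewrite (negPf nc).
  move=> c _ /=; rewrite /psize /plen -map_comp.
  elim: (parts (u c)) => [|k t /= ->]; first by rewrite muln0.
  by rewrite mulnS; lia.
have cnt k c : count_mem (k + (c == c0), c) ks = pmult k (u c).
  rewrite /ks count_flatten -map_comp sumnE big_map big_enum /=.
  rewrite (bigD1 c) //= big1 ?addn0 => [|d nd]; rewrite count_map.
    by apply: eq_count => j /=; rewrite /f xpair_eqE eqxx andbT eqn_add2r.
  rewrite (eq_count (a2 := pred0)) ?count_pred0 // => j /=.
  by rewrite xpair_eqE (negPf nd) andbF.
have le_ks : sumn (unzip1 ks) <= stable_bound u by rewrite sum_ks.
have [z typ_z] := exists_cycles ks0 le_ks.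
exists z; apply: mtype_eqP => [k c k0 nc|k].
  by rewrite typ_z // xpair_eqE (negPf nc) andbF addn0 -cnt (negPf nc) addn0.
by rewrite typ_z // addn0 -cnt eqxx addn1.
Qed.

End Existence.

(** * Types of the products *)

(** The sizes of the [r] cycles glued for a partition [mu] with at most [r]
    parts: as a part [k] of a modified type at the trivial class is a cycle of
    size [k + 1], these are the parts of [mu] increased by one, completed by
    fixed points. *)
Definition gapseq (mu : intpart) r : seq nat :=
  map succn mu ++ nseq (r - plen mu) 1.

Lemma size_gapseq mu r : plen mu <= r -> size (gapseq mu r) = r.
Proof. by move=> le_r; rewrite size_cat size_map size_nseq subnKC. Qed.

Lemma sumn_gapseq mu r : plen mu <= r -> sumn (gapseq mu r) = psize mu + r.
Proof.
move=> le_r; rewrite sumn_cat sumn_nseq mul1n.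
have -> : sumn (map succn mu) = psize mu + plen mu.
  by rewrite /psize /plen; elim: (parts mu) => //= k s ->; lia.
by rewrite -addnA subnKC.
Qed.

Lemma count_gapseq0 mu r : count_mem 0 (gapseq mu r) = 0.
Proof.
rewrite count_cat count_map count_nseq /= addn0.
by rewrite (eq_count (a2 := pred0)) ?count_pred0.
Qed.

Lemma count_gapseq1 mu r : count_mem 1 (gapseq mu r) = r - plen mu.
Proof.
rewrite count_cat count_map count_nseq /= mul1n.
have -> : count (preim succn (pred1 1)) mu = pmult 0 mu by apply: eq_count.
by rewrite pmult0.
Qed.

Lemma count_gapseq mu r k : count_mem k.+2 (gapseq mu r) = pmult k.+1 mu.
Proof.
by rewrite count_cat count_map count_nseq /= addn0; apply: eq_count => -[].
Qed.

Lemma count_mem0_gt0 (s : seq nat) : all (leq 1) s -> count_mem 0 s = 0.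
Proof. by move=> s0; apply/count_memPn/negP => /(allP s0). Qed.

(** Every list of positive sizes arises from a partition in this way. *)
Lemma gapseq_pred (s : seq nat) : all (leq 1) s ->
  perm_eq s (gapseq (mkpart (map predn s)) (size s))
  /\ plen (mkpart (map predn s)) <= size s.
Proof.
move=> s0; set mu := mkpart _.
have le_mu : plen mu <= size s.
  rewrite /plen /= size_sort size_filter.
  by rewrite (leq_trans (count_size _ _)) ?size_map.
split=> //; apply: (@perm_eq_but1 _ _ 1); first by rewrite size_gapseq.
case=> [|[//|k]] _; first by rewrite count_gapseq0 count_mem0_gt0.
rewrite count_gapseq pmult_mkpart // count_map; apply: eq_count.
by case.
Qed.

Section Counting.

Variables (gT : finGroupType).
Implicit Types (c d : conjcl gT) (l : ptype gT).

Local Notation c0 := (conjcl1 gT).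

(** The index of the basis element contributed by [mu] to the product of
    [K_l] by [K_(r)_c]. *)
Definition rowtype l r c mu : ptype gT :=
  tdiff (tcup l (trow (psize mu + r) c)) (tsupp c0 mu).

Lemma pmult_rowtype1 l r c mu k : 0 < k -> c != c0 ->
  pmult k (rowtype l r c mu c0) = pmult k (l c0) - pmult k mu.
Proof.
move=> k0 nc; rewrite /rowtype !ffunE pmult_pdiff pmult_pcup.
by rewrite eqxx eq_sym (negPf nc) pmult_mkpart //= addn0.
Qed.

Lemma pmult_rowtype l r c mu k d : 0 < k -> d != c0 ->
  pmult k (rowtype l r c mu d)
    = pmult k (l d) + ((k, d) == (psize mu + r, c)).
Proof.
move=> k0 nd; rewrite {1}/rowtype ffunE pmult_pdiff [tcup _ _ _]ffunE.
rewrite pmult_pcup pmult_trow // [tsupp _ _ _]ffunE (negPf nd).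
rewrite [pmult k emptyp]pmult_mkpart //=.
by rewrite subn0.
Qed.

Lemma psize_pdiff (p q : intpart) : psub q p ->
  psize (pdiff p q) + psize q = psize p.
Proof.
move/psubP => sub_qp.
have [N [le1 le2 le3]] :
    exists N, [/\ psize (pdiff p q) <= N, psize q <= N & psize p <= N].
  by exists (psize (pdiff p q) + psize q + psize p); split; lia.
rewrite (psize_pmult le1) (psize_pmult le2) (psize_pmult le3).
rewrite -big_split; apply: eq_bigr => i _ /=.
by rewrite -mulnDr pmult_pdiff subnK.
Qed.

Lemma tnorm_rowtype l r c mu : psub mu (l c0) -> c != c0 ->
  tnorm (rowtype l r c mu) = tnorm l + r.
Proof.
move=> sub_mu nc; apply: (@addIn (psize mu)).
rewrite -addnA [r + _]addnC /tnorm.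
(* Both constants are spread over the classes as sums with a single nonzero
   term, so that the identity can be checked class by class. *)
have delta d k : k = \sum_e (e == d :> conjcl gT) * k.
  by rewrite -big_distrl /= (bigD1 d) //= eqxx big1 ?mul1n // => e /negPf->.
transitivity (\sum_d (psize (rowtype l r c mu d) + (d == c0) * psize mu)).
  by rewrite big_split -delta.
transitivity (\sum_d (psize (l d) + (d == c) * (psize mu + r))); last first.
  by rewrite big_split -delta.
apply: eq_bigr => d _; rewrite /rowtype !ffunE.
have sz_cup :
    psize (pcup (l d) (if d == c then mkpart [:: psize mu + r] else emptyp))
    = psize (l d) + (d == c) * (psize mu + r).
  rewrite /pcup psize_mkpart sumn_cat; congr addn.
  by case: eqP => _; rewrite -/(psize _) psize_mkpart //= addn0 mul1n.
rewrite -sz_cup; have [ed|nd] := eqVneq d c0.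
  rewrite mul1n psize_pdiff //; apply/psubP => i; rewrite pmult_pcup ed.
  by rewrite (leq_trans (psubP _ _ sub_mu i)) ?leq_addr.
rewrite mul0n addn0 -[in RHS](@psize_pdiff _ emptyp) //.
by rewrite [psize emptyp]psize_mkpart addn0.
Qed.

Section FixedDegree.

Variable n : nat.
Implicit Types (x y z : wreath gT n) (i j s : 'I_n).

Local Open Scope group_scope.

(** When [x * y] has the type contributed by [mu], the type of [x] is [l] if and
    only if the gaps are those of [mu], up to order. *)
Lemma glue_gaps_perm x y s l r c mu : c != c0 ->
    supported_on y (porbit (wperm y) s) -> gluable x (porbit (wperm y) s) ->
    ckey y s = (r, c) -> psub mu (l c0) -> plen mu <= r ->
    mtype (x * y) = rowtype l r c mu ->
  (mtype x == l) = perm_eq (gaps x y s) (gapseq mu r).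
Proof.
move=> nc supp_y glue_x [sz_s cl_s] /psubP sub_mu le_mu typ_z.
have gw := glue_wtype supp_y glue_x; rewrite cl_s in gw.
have gw1 k : (pmult k.+1 (l c0) - pmult k.+1 mu + count_mem k.+2 (gaps x y s)
    = pmult k.+2 (wtype x c0))%N.
  have := gw k.+2 c0 isT; rewrite -pmult_mtype1 typ_z pmult_rowtype1 // eqxx.
  by rewrite xpair_eqE [c0 == c]eq_sym (negPf nc) andbF mul1n addn0.
apply/eqP/idP => [typ_x|eq_g].
  apply: (@perm_eq_but1 _ _ 1%N).
    by rewrite size_gaps size_gapseq.
  case=> [|[//|k]] _.
    by rewrite count_gapseq0 count_mem0_gt0 // gaps_gt0.
  have := gw1 k; rewrite -pmult_mtype1 typ_x count_gapseq.
  by have := sub_mu k.+1; lia.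
apply: mtype_eqP => [k d k0 nd|k].
  have := gw k d k0; rewrite (negPf nd) mul0n addn0 -mtype_neq1 // typ_z.
  rewrite pmult_rowtype // (perm_sumn eq_g) sumn_gapseq //.
  by move/eqP; rewrite eqn_add2r => /eqP->.
by rewrite -gw1 (seq.permP eq_g) count_gapseq subnK.
Qed.

(** Only the types [rowtype] occur in products with additive norms. *)
Lemma product_rowtype x y r c : 0 < r -> c != c0 -> mtype y = trow r c ->
    tnorm (mtype (x * y)) = (tnorm (mtype x) + r)%N ->
  exists mu, [/\ psub mu (mtype x c0), plen mu <= r
               & mtype (x * y) = rowtype (mtype x) r c mu].
Proof.
move=> r0 nc my norm_xy; have glue_x := norm_gluable r0 nc my norm_xy.
have supp_y := supported_row r0 nc my.
have /card_gt0P[s sT] : 0 < #|kpts y r c| by rewrite card_kpts_row.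
have orb_s := porbit_row r0 nc my sT.
have /eqP ks : ckey y s == (r, c) by rewrite inE in sT.
have sz_s : #|porbit (wperm y) s| = r := congr1 fst ks.
have cl_s : clof (cycprod y s) = c := congr1 snd ks.
rewrite -orb_s in glue_x supp_y.
have [perm_g le_mu] := gapseq_pred (gaps_gt0 x y s).
move: perm_g le_mu; set mu := mkpart _; rewrite size_gaps sz_s => perm_g le_mu.
have gw := glue_wtype supp_y glue_x; rewrite cl_s in gw.
have gw1 k : (pmult k.+1 (mtype (x * y)%g c0) + pmult k.+1 mu
    = pmult k.+1 (mtype x c0))%N.
  rewrite !pmult_mtype1 -(count_gapseq mu r) -(seq.permP perm_g).
  have := gw k.+2 c0 isT; rewrite eqxx mul1n => ->.
  by rewrite xpair_eqE [c0 == c]eq_sym (negPf nc) andbF addn0.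
exists mu; split=> //.
  by apply/psubP => -[|k]; rewrite ?pmult0 // -gw1 leq_addl.
apply/ffunP => d; apply: eq_intpart => -[//|k] _.
have [->|nd] := eqVneq d c0; first by rewrite pmult_rowtype1 // -gw1 addnK.
rewrite pmult_rowtype // !mtype_neq1 //.
have := gw k.+1 d isT; rewrite (negPf nd) mul0n addn0 => ->.
by rewrite (perm_sumn perm_g) sumn_gapseq.
Qed.

End FixedDegree.
End Counting.

(** * Cutting a cycle *)

Section Cutting.

Variables (gT : finGroupType) (n : nat).
Implicit Types (c : conjcl gT) (x y z : wreath gT n) (i j s : 'I_n).

Local Open Scope group_scope.

(** The converse of gluing: for every list [ks] of positive integers whose sum
    is the size of the cycle of [z] through [s], that cycle can be cut into
    cycles of trivial product of sizes [ks].  The factor [y] is the first-return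
    map of [z], labels included, on the points that are reached from [s] after
    the partial sums of [ks]. *)
Lemma cut_cycle z s (ks : seq nat) :
    all (leq 1) ks -> (0 < size ks)%N -> sumn ks = #|porbit (wperm z) s| ->
  exists x y, [/\ z = x * y, supported_on y (porbit (wperm y) s),
    gluable x (porbit (wperm y) s), ckey y s = (size ks, clof (cycprod z s))
    & gaps x y s = ks].
Proof.
move=> ks0 r0 sum_ks; set r := size ks in r0 *.
(* t m is the time at which the m-th point is reached. *)
pose t m := sumn (take m ks).
have tS m : m < r -> t m.+1 = (t m + nth 0%N ks m)%N.
  by move=> lt_m; rewrite /t (take_nth 0%N) // sumn_rcons.
have k_gt0 m : m < r -> 0 < nth 0%N ks m.
  by move=> lt_m; apply/(allP ks0)/mem_nth.
have t_homo m p : m <= p -> p <= r -> t m <= t p.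
  move/subnKC => <-; elim: (p - m)%N => [|d IHd]; first by rewrite addn0.
  rewrite addnS => lt_r; rewrite tS //.
  by rewrite (leq_trans (IHd (ltnW lt_r))) ?leq_addr.
have t_r : t r = #|porbit (wperm z) s| by rewrite /t take_size.
have t_lt m : m < r -> t m < #|porbit (wperm z) s|.
  move=> lt_m; rewrite -t_r (leq_trans _ (t_homo m.+1 r _ _)) //.
  by rewrite tS // -[X in X < _]addn0 ltn_add2l k_gt0.
have t_inj m p : m < r -> p < r -> t m = t p -> m = p.
  have t_ltn a b : a < b -> b < r -> t a < t b.
    move=> ab br; rewrite (leq_trans _ (t_homo a.+1 b _ _)) ?(ltnW br) //.
    rewrite tS ?(ltn_trans ab) // -[X in X < _]addn0 ltn_add2l.
    by rewrite k_gt0 ?(ltn_trans ab).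
  move=> lt_m lt_p e; case: (ltngtP m p) => // [mp|pm].
    by have := t_ltn m p mp lt_p; rewrite e ltnn.
  by have := t_ltn p m pm lt_m; rewrite e ltnn.
pose pt m := iter (t m) (wperm z) s.
pose ps := mkseq pt r.
have sz_ps : size ps = r by rewrite size_mkseq.
have nth_ps m : m < r -> nth s ps m = pt m by move=> lt_m; rewrite nth_mkseq.
have Ups : uniq ps.
  apply/(uniqP s) => m p; rewrite !inE !sz_ps => lt_m lt_p.
  rewrite !nth_ps // /pt => /(eq_iter_porbit (t_lt m lt_m) (t_lt p lt_p)).
  exact: t_inj.
have idx m : m < r -> index (pt m) ps = m.
  by move=> lt_m; rewrite -nth_ps // index_uniq ?sz_ps.
have ptin m : m < r -> pt m \in ps.
  by move=> lt_m; rewrite -nth_ps // mem_nth ?sz_ps.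
have ps_pt i : i \in ps -> exists2 m, m < r & i = pt m.
  by case/(nthP s) => m; rewrite sz_ps => lt_m <-; exists m; rewrite ?nth_ps.
have pt0 : pt 0%N = s by rewrite /pt /t take0.
have sps : s \in ps by rewrite -pt0 ptin.
have ptr : pt r = s by rewrite /pt t_r iter_porbit.
(* For m = r - 1 this is the return to the first point of the list, which is
   also pt r. *)
have next_pt m : m < r -> next ps (pt m) = pt m.+1.
  move=> lt_m; rewrite next_nth ptin // idx //.
  case def_ps: ps => [|s' ps']; first by rewrite -sz_ps def_ps in lt_m.
  have -> : s' = s by rewrite -pt0 -nth_ps // def_ps.
  have [lt_m1|] := ltnP m.+1 r; first by rewrite -nth_ps // def_ps.
  move=> le_r; have -> : m.+1 = r by apply/eqP; rewrite eqn_leq lt_m.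
  rewrite ptr nth_default //.
  by move: sz_ps; rewrite def_ps /=; move: le_r; lia.
have ptS m : m < r -> iter (nth 0%N ks m) (wperm z) (pt m) = pt m.+1.
  by move=> lt_m; rewrite /pt tS // addnC iterD.
have [y [supp_y wtr_y orb_y]] := exists_cycle
  (fun i => (iter (nth 0%N ks (index i ps)) (wtr z) (1, i)).1) Ups.
have orb_s := orb_y s sps; rewrite -orb_s in supp_y.
have mem_ps i : (i \in porbit (wperm y) s) = (i \in ps) by rewrite orb_s inE.
have sz_s : #|porbit (wperm y) s| = r by rewrite orb_s cardsE (card_uniqP Ups).
(* On the m-th point, y acts as the corresponding power of z. *)
have y_jump m a : m < r ->
    wtr y (a, pt m) = iter (nth 0%N ks m) (wtr z) (a, pt m).
  move=> lt_m; rewrite -wtrX; apply: wtr_eq1; rewrite wtrX wtr_y ?ptin //.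
  by rewrite idx // next_pt // [RHS]surjective_pairing iter_wtr_snd ptS.
have yt m : m <= r -> iter m (wtr y) (1, s) = iter (t m) (wtr z) (1, s).
  elim: m => [|m IHm] lt_m; first by rewrite /t take0.
  rewrite iterS IHm ?(ltnW lt_m) // tS // addnC iterD.
  by rewrite [iter (t m) _ _]iter_wtr y_jump.
have y_pt m : m <= r -> iter m (wperm y) s = pt m.
  by move=> le_m; have := congr1 snd (yt m le_m); rewrite !iter_wtr_snd.
have y_class : clof (cycprod y s) = clof (cycprod z s).
  by rewrite !clof_cycprod sz_s yt // t_r.
pose x := z * y^-1; have xyE : x * y = z by rewrite /x mulgKV.
have wtr_xy p : wtr x (wtr y p) = wtr z p by rewrite -wtrM xyE.
(* z does not meet the list ps strictly between two consecutive points. *)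
have between m p : m < r -> 0 < p < nth 0%N ks m ->
    iter p (wperm z) (pt m) \notin ps.
  move=> lt_m /andP[p0 lt_p]; apply/negP => /ps_pt[q lt_q].
  have lt_pm : p + t m < t m.+1 by rewrite tS // addnC ltn_add2l.
  have le_z : p + t m < #|porbit (wperm z) s|.
    by rewrite -t_r (leq_trans lt_pm) ?t_homo.
  rewrite /pt -iterD => /(eq_iter_porbit le_z (t_lt q lt_q)) e.
  case: (leqP q m) => [le_qm|lt_mq].
    by have := t_homo q m le_qm (ltnW lt_m); rewrite -e; lia.
  by have := t_homo m.+1 q lt_mq (ltnW lt_q); rewrite -e leqNgt lt_pm.
have x_off i a : i \notin ps -> wtr x (a, i) = wtr z (a, i).
  move=> ni; have supp_i : wtr y (a, i) = (a, i).
    by apply: (wtr_supported supp_y); rewrite mem_ps.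
  by rewrite -{1}supp_i wtr_xy.
(* The cycle of x through the image by y of the m-th point follows the path of
   z from the m-th point to the next one. *)
have x_iter m p a : m < r -> p < nth 0%N ks m ->
    iter p.+1 (wtr x) (wtr y (a, pt m)) = iter p.+1 (wtr z) (a, pt m).
  move=> lt_m; elim: p => [|p IHp] lt_p.
    exact: wtr_xy.
  rewrite iterS IHp ?(ltnW lt_p) // [RHS]iterS [iter p.+1 _ _]iter_wtr.
  by rewrite x_off // between.
have x_ret m a : m < r ->
    iter (nth 0%N ks m) (wtr x) (a, pt m.+1) = (a, pt m.+1).
  move=> lt_m; have [b def_b] : exists b, wtr y (b, pt m) = (a, pt m.+1).
    have e2 : wperm y (pt m) = pt m.+1.
      by have := congr1 snd (y_jump m 1 lt_m); rewrite iter_wtr_snd ptS.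
    exists ((wtr y (1, pt m)).1^-1 * a).
    by rewrite -[_^-1 * a]mul1g wtr_fstM mulKVg e2.
  rewrite -def_b; have := x_iter m (nth 0%N ks m).-1 b lt_m.
  by rewrite prednK ?k_gt0 // => -> //; rewrite y_jump.
have x_pts m p : m < r -> 0 < p < nth 0%N ks m ->
    iter p (wperm x) (pt m.+1) \notin ps.
  move=> lt_m pP; have := between m p lt_m pP.
  case: p pP => // p /andP[_ lt_p].
  have := congr1 snd (x_iter m p 1 lt_m (ltnW lt_p)).
  by rewrite !iter_wtr_snd y_jump // iter_wtr_snd /= ptS // => <-.
have ptin1 m : m < r -> pt m.+1 \in ps.
  by rewrite leq_eqVlt => /predU1P[->|/ptin //]; rewrite ptr.
have x_card m : m < r -> #|porbit (wperm x) (pt m.+1)| = nth 0%N ks m.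
  move=> lt_m; apply: card_porbit_first => [||p pP]; first exact: k_gt0.
    by have := congr1 snd (x_ret m 1 lt_m); rewrite iter_wtr_snd.
  by apply: contraNneq (x_pts m p lt_m pP) => ->; exact: ptin1.
have ps_pt1 i : i \in ps -> exists2 m, m < r & i = pt m.+1.
  case/ps_pt => -[|m] lt_m ->; last by exists m; rewrite ?(ltnW lt_m).
  by exists r.-1; rewrite prednK // ptr pt0.
exists x, y; split=> //.
- move=> i; rewrite mem_ps => /ps_pt1[m lt_m ->]; split=> [|j].
    by apply/eqP; rewrite clof_cycprod clof1 x_card // x_ret.
  rewrite mem_ps => jps /porbit_in_iter1[p]; rewrite x_card // => /andP[p0].
  rewrite leq_eqVlt => /predU1P[->|lt_p] def_j; last first.
    by have := x_pts m p lt_m; rewrite p0 lt_p -def_j jps => /(_ isT).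
  by have := congr1 snd (x_ret m 1 lt_m); rewrite iter_wtr_snd -def_j.
- by rewrite /ckey sz_s y_class.
apply: (@eq_from_nth _ 0%N); rewrite size_gaps sz_s // => m lt_m.
by rewrite nth_gaps ?sz_s // y_pt // x_card.
Qed.

End Cutting.

(** * Counting factorizations *)

Section Factorizations.

Variables (gT : finGroupType) (n : nat).
Implicit Types (c : conjcl gT) (l : ptype gT) (x y z : wreath gT n).
Implicit Types (i j s : 'I_n).

Local Notation c0 := (conjcl1 gT).
Local Open Scope group_scope.

(** A product with gluing is determined by the starting point [s] and the list
    of gaps: these give the points of the cycle of [y], and the action of [y] on
    them as powers of [x * y]. *)
Lemma gaps_inj x y x' y' s :
    supported_on y (porbit (wperm y) s) -> gluable x (porbit (wperm y) s) ->
    supported_on y' (porbit (wperm y') s) -> gluable x' (porbit (wperm y') s) ->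
    x * y = x' * y' -> gaps x y s = gaps x' y' s ->
  y = y'.
Proof.
move=> supp_y glue_x supp_y' glue_x' eq_xy eq_g.
have sz : #|porbit (wperm y') s| = #|porbit (wperm y) s|.
  by rewrite -(size_gaps x y) -(size_gaps x' y') eq_g.
have eq_it m : m <= #|porbit (wperm y) s| ->
    iter m (wtr y) (1, s) = iter m (wtr y') (1, s).
  move=> le_m; rewrite -(glue_winding supp_y glue_x) //.
  by rewrite eq_xy eq_g (glue_winding supp_y' glue_x') // sz.
have eq_pt m : m <= #|porbit (wperm y) s| ->
    iter m (wperm y) s = iter m (wperm y') s.
  by move=> /eq_it/(congr1 snd); rewrite !iter_wtr_snd.
have eq_orb : porbit (wperm y) s = porbit (wperm y') s.
  apply/eqP; rewrite eqEcard sz leqnn andbT; apply/subsetP => i.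
  case/porbit_in_iter => m lt_m ->.
  by rewrite eq_pt ?(ltnW lt_m) // iter_perm_orbit.
apply: wtr_inj => i.
have [iS|iS] := boolP (i \in porbit (wperm y) s); last first.
  by rewrite supp_y // supp_y' // -eq_orb.
have [m lt_m def_i] := porbit_in_iter iS.
have iS' : i \in porbit (wperm y') s by rewrite -eq_orb.
rewrite -(glue_return supp_y glue_x _ iS) -(glue_return supp_y' glue_x' _ iS').
rewrite eq_xy; congr (iter _ _ _).
have := congr1 (fun g => nth 0%N g m) eq_g.
by rewrite !nth_gaps ?sz // !iterS -(eq_pt m) ?(ltnW lt_m) // -def_i.
Qed.

(** The left factors [x] of the factorizations of [z] as a product of an element
    of modified type [l] and an element of modified type [(r)_c]. *)
Definition factors l r c z :=
  [set x : wreath gT n | (mtype x == l) && (mtype (x^-1 * z) == trow r c)].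

(** A factorization [z = x * y] together with a point [s] of the support of [y]
    amounts to a point [s] of [z] on a cycle of size [psize mu + r] and class
    [c], together with a rearrangement of [gapseq mu r]. *)
Lemma card_factors l r c mu z : 0 < r -> c != c0 -> psub mu (l c0) ->
    plen mu <= r -> mtype z = rowtype l r c mu ->
  (r * #|factors l r c z| = #|kpts z (psize mu + r) c|
     * size (permutations (gapseq mu r)))%N.
Proof.
move=> r0 nc sub_mu le_mu typ_z.
pose y x := x^-1 * z.
have xyE x : x * y x = z by rewrite /y mulKVg.
pose P := [set p : wreath gT n * 'I_n |
  (p.1 \in factors l r c z) && (p.2 \in kpts (y p.1) r c)].
have factorP x s : (x, s) \in P ->
    [/\ mtype x = l, mtype (y x) = trow r c,
        ckey (y x) s = (r, c),
        supported_on (y x) (porbit (wperm (y x)) s)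
      & gluable x (porbit (wperm (y x)) s)].
  rewrite !inE /= => /andP[/andP[/eqP typ_x /eqP typ_y] /eqP ks].
  have sT : s \in kpts (y x) r c by rewrite inE ks.
  rewrite (porbit_row r0 nc typ_y sT); split=> //.
    exact: supported_row.
  by apply: norm_gluable; rewrite // xyE typ_x typ_z tnorm_rowtype.
have cardP : #|P| = (r * #|factors l r c z|)%N.
  rewrite -sum1_card (eq_bigl (fun p =>
    (p.1 \in factors l r c z) && (p.2 \in kpts (y p.1) r c))); last first.
    by move=> p; rewrite inE.
  rewrite -(pair_big_dep (mem (factors l r c z))
    (fun x s => s \in kpts (y x) r c) (fun _ _ => 1%N)) /=.
  rewrite mulnC -sum_nat_const; apply: eq_bigr => x; rewrite inE.
  case/andP=> _ /eqP typ_y.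
  by rewrite sum1_card card_kpts_row.
rewrite -cardP cardE -(size_map (fun p => (p.2, gaps p.1 (y p.1) p.2))).
rewrite [#|kpts _ _ _|]cardE -(size_allpairs (fun s g => (s, g))).
apply/perm_size/uniq_perm.
- rewrite map_inj_in_uniq ?enum_uniq // => -[x s] [x' s'].
  rewrite !mem_enum => /factorP[_ _ _ supp_y glue_x].
  move/factorP=> [_ _ _ supp_y' glue_x'].
  case=> es eg; rewrite -es /= in supp_y' glue_x' eg *; congr pair.
  have eqy := gaps_inj supp_y glue_x supp_y' glue_x' _ eg.
  by apply: (mulIg (y x)); rewrite {2}eqy ?xyE.
- apply: allpairs_uniq; rewrite ?enum_uniq ?permutations_uniq //.
  by move=> [? ?] [? ?] _ _ [-> ->].
move=> [s g]; apply/mapP/allpairsP => [[[x s'] + [-> ->]]|[[s' g'] /= []]].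
  rewrite mem_enum => /factorP[typ_x typ_y ks supp_y glue_x].
  have sz_g : perm_eq (gaps x (y x) s') (gapseq mu r).
    by rewrite -(glue_gaps_perm nc supp_y glue_x ks sub_mu) ?typ_x ?xyE.
  exists (s', gaps x (y x) s'); split=> //=; last by rewrite mem_permutations.
  have s_in : s' \in \bigcup_(i in porbit (wperm (y x)) s') porbit (wperm x) i.
    by apply/bigcupP; exists s'; exact: porbit_id.
  have := glue_ckey_in supp_y glue_x s_in; rewrite xyE (perm_sumn sz_g).
  by rewrite sumn_gapseq // (congr1 snd ks : clof _ = _) mem_enum inE => ->.
rewrite mem_enum inE mem_permutations => /eqP ks perm_g [-> ->] {s g}.
have g0 : all (leq 1) g'.
  rewrite (perm_all _ perm_g); apply/allP => k.
  apply: contraLR; rewrite -leqNgt leqn0.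
  by move/eqP->; apply/count_memPn; rewrite count_gapseq0.
have szg : size g' = r by rewrite (perm_size perm_g) size_gapseq.
have [||x [y' [def_z supp_y glue_x ky eg]]] := @cut_cycle _ _ z s' g' g0.
- by rewrite szg.
- by rewrite (perm_sumn perm_g) sumn_gapseq // (congr1 fst ks : #|_| = _).
have ey : y x = y' by rewrite /y def_z mulKg.
rewrite szg (congr1 snd ks : clof _ = _) in ky.
exists (x, s'); rewrite /= ?ey ?eg // mem_enum !inE /= -/(y x) ey ky eqxx andbT.
rewrite (row_mtype r0 nc supp_y ky) eqxx andbT.
by rewrite (glue_gaps_perm nc supp_y glue_x ky sub_mu) -?def_z // eg.
Qed.

End Factorizations.

(** * The structure constants *)

Section Coefficients.

Variable gT : finGroupType.
Implicit Types (c : conjcl gT) (l u : ptype gT) (mu : intpart).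

Local Notation c0 := (conjcl1 gT).

Lemma size_permutations_gapseq mu r : plen mu <= r ->
  size (permutations (gapseq mu r))
    * ((r - plen mu)`! * \prod_(1 <= i < (psize mu).+1) (pmult i mu)`!) = r`!.
Proof.
move=> le_mu; have g_lt : all (fun a => a < (psize mu).+2) (gapseq mu r).
  rewrite all_cat all_nseq orbT andbT all_map.
  by apply/allP => k /leq_part_psize.
rewrite -[in RHS](size_gapseq le_mu) -(size_permutations_count g_lt).
rewrite [X in _ = _ * X]big_ltn // [X in _ = _ * (_ * X)]big_ltn //.
rewrite count_gapseq0 count_gapseq1 fact0 mul1n.
rewrite !big_add1 /=; congr (_ * (_ * _)).
by apply: eq_bigr => i _; rewrite count_gapseq.
Qed.

(** Each of the [pmult (psize mu + r) (l c) + 1] cycles of size [psize mu + r]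
    and class [c] has [psize mu + r] points, and there are
    [r! / ((r - plen mu)! prod_i m_i(mu)!)] lists of gaps; the [r] choices of
    the point on the cycle of [y] are divided out. *)
Lemma card_factorsE n l r c mu (z : wreath gT n) : 0 < r -> c != c0 ->
    psub mu (l c0) -> plen mu <= r -> mtype z = rowtype l r c mu ->
  #|factors l r c z| =
    ((pmult (psize mu + r) (l c) + 1) * (psize mu + r) * (r - 1)`!)
      %/ ((r - plen mu)`! * \prod_(1 <= i < (psize mu).+1) (pmult i mu)`!).
Proof.
move=> r0 nc sub_mu le_mu typ_z; set D := (X in _ %/ X).
have D0 : 0 < D.
  by rewrite muln_gt0 fact_gt0 prodn_gt0 // => i; exact: fact_gt0.
have L0 : 0 < psize mu + r by rewrite addn_gt0 r0 orbT.
rewrite -[LHS](mulnK _ D0); congr (_ %/ _); apply/eqP.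
rewrite -(eqn_pmul2l r0) mulnA (card_factors r0 nc sub_mu le_mu typ_z) -mulnA.
rewrite size_permutations_gapseq // card_kpts // -mtype_neq1 // typ_z.
rewrite pmult_rowtype // eqxx -[r in r`!]prednK // factS prednK // subn1.
by rewrite mulnCA [X in r * (X * _)]mulnC.
Qed.

Lemma rowtype_inj l r c mu mu' : c != c0 -> psub mu (l c0) -> psub mu' (l c0) ->
  rowtype l r c mu = rowtype l r c mu' -> mu = mu'.
Proof.
move=> nc /psubP sub_mu /psubP sub_mu' eq_t.
apply: eq_intpart => i i0.
have := congr1 (fun t : ptype gT => pmult i (t c0)) eq_t.
by rewrite !pmult_rowtype1 //; have := sub_mu i; have := sub_mu' i; lia.
Qed.

Lemma tnorm_trow r c : tnorm (trow r c) = r.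
Proof.
rewrite /tnorm (bigD1 c) //= big1 => [|d nd].
  by rewrite ffunE eqxx psize_mkpart /= !addn0.
by rewrite ffunE (negPf nd) psize_mkpart.
Qed.

Local Open Scope ring_scope.

Lemma gring_mul_Kn n l r c (z : wreath gT n) :
  gring_mul (Kn n l) (Kn n (trow r c)) z = #|factors l r c z|%:Z.
Proof.
rewrite /gring_mul ffunE -natz -sum1_card natr_sum [RHS]big_mkcond /=.
by apply: eq_bigr => x _; rewrite !ffunE inE; case: (_ == l); case: (_ == _).
Qed.

Lemma FHcoef_rowtype l r c mu : (0 < r)%N -> c != c0 ->
    psub mu (l c0) -> (plen mu <= r)%N ->
  FHcoef l (trow r c) (rowtype l r c mu) =
    (((pmult (psize mu + r) (l c) + 1) * (psize mu + r) * (r - 1)`!)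
       %/ ((r - plen mu)`!
           * \prod_(1 <= i < (psize mu).+1) (pmult i mu)`!))%N%:Z.
Proof.
move=> r0 nc sub_mu le_mu; rewrite /FHcoef /Kcoef.
case: pickP => [z /eqP typ_z|no_z].
  by rewrite gring_mul_Kn (card_factorsE r0 nc sub_mu le_mu typ_z).
have [z typ_z] := exists_mtype (rowtype l r c mu).
by have := no_z z; rewrite typ_z eqxx.
Qed.

Lemma FHcoef_not_rowtype l r c u : (0 < r)%N -> c != c0 ->
    tnorm u = (tnorm l + r)%N ->
    (forall mu, psub mu (l c0) -> (plen mu <= r)%N -> rowtype l r c mu != u) ->
  FHcoef l (trow r c) u = 0.
Proof.
move=> r0 nc norm_u no_mu; rewrite /FHcoef /Kcoef.
case: pickP => // z /eqP typ_z; rewrite gring_mul_Kn.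
suff -> : factors l r c z = set0 by rewrite cards0.
apply/setP => x; rewrite !inE; apply/negP => /andP[/eqP typ_x /eqP typ_y].
have xyE : (x * (x^-1 * z) = z)%g by rewrite mulKVg.
have := product_rowtype r0 nc typ_y (x := x).
rewrite xyE typ_x typ_z => /(_ norm_u)[mu [sub_mu le_mu eq_u]].
by have := no_mu mu sub_mu le_mu; rewrite eq_u eqxx.
Qed.

End Coefficients.

Local Open Scope ring_scope.

Theorem theorem3p3 (gT : finGroupType) (l : ptype gT) (r : nat)
    (c : conjcl gT) (hr : (1 <= r)%N) (hc : c != conjcl1 gT) :
  FHmul (FHK l) (FHK (trow r c)) =
  \sum_(mu <- subparts (l (conjcl1 gT)) | (plen mu <= r)%N)
    (((pmult (psize mu + r) (l c) + 1) * (psize mu + r) * (r - 1)`!)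
       %/ ((r - plen mu)`!
           * \prod_(1 <= i < (psize mu).+1) (pmult i mu)`!))%N%:Z
    *: FHK (tdiff (tcup l (trow (psize mu + r) c)) (tsupp (conjcl1 gT) mu)).
Proof.
rewrite FHmul_basis; apply/malgP => u.
rewrite FHmulK_coef tnorm_trow raddf_sum /=.
under eq_bigr => mu _ do rewrite mcoeffZ mcoeffU -/(rowtype l r c mu).
have [/hasP[mu]|no_mu] := boolP (has (fun mu => (plen mu <= r)%N
  && (rowtype l r c mu == u)) (subparts (l (conjcl1 gT)))).
  rewrite mem_subparts => sub_mu /andP[le_mu /eqP def_u].
  rewrite big_mkcond (bigD1_seq mu) ?mem_subparts ?subparts_uniq //=.
  rewrite le_mu -def_u eqxx mulr1 tnorm_rowtype // eqxx FHcoef_rowtype //.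
  rewrite [X in _ + X]big_seq_cond [X in _ + X]big1 ?addr0 // => mu' /andP[].
  rewrite mem_subparts => sub_mu' neq_mu; case: ifP => // _.
  case: eqP => [eq_t|_]; last by rewrite mulr0.
  by rewrite (rowtype_inj hc sub_mu' sub_mu eq_t) eqxx in neq_mu.
have not_u mu : psub mu (l (conjcl1 gT)) -> (plen mu <= r)%N ->
    rowtype l r c mu != u.
  rewrite -mem_subparts => mu_in le_mu; apply: contra no_mu => eq_u.
  by apply/hasP; exists mu; rewrite // le_mu.
rewrite big_seq_cond big1 => [|mu /andP[]]; last first.
  rewrite mem_subparts => sub_mu le_mu.
  by rewrite (negPf (not_u mu sub_mu le_mu)) mulr0.
by case: eqP => // norm_u; rewrite FHcoef_not_rowtype.
Qed.
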